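(* Let $S$ be a complex manifold of dimension $n$, $p\in S$, so $(S,p)\cong(\mathbb{C}^n,0)$, and let $(D,p)=(D_1,p)\cup(D_2,p)\subseteq(S,p)$ be a divisor such that $(D_1,p)=\{g=0\}$ and $(D_2,p)=\{h=0\}$ for some reduced non-units $g,h\in\mathcal{O}_{S,p}$, not necessarily irreducible but with no common factor. Then $D=D_1\cup D_2$ is splayed at $p$ if and only if $$\operatorname{Der}_{S,p}(\log D_1)+\operatorname{Der}_{S,p}(\log D_2)=\operatorname{Der}_{S,p}.$$
   Context: Work in the complex analytic category. $\mathcal{O}_{S,p}\cong\mathbb{C}\{x_1,\dots,x_n\}$ is the local ring of germs of holomorphic functions at $p$, with $(x_1,\dots,x_n)$ complex coordinates of $S$ at $p$. A divisor is a hypersurface; its local defining equations are always taken reduced (square-free). $\operatorname{Der}_{S,p}$ is the $\mathcal{O}_{S,p}$-module of germs at $p$ of holomorphic vector fields on $S$ (the free module on $\partial_{x_1},\dots,\partial_{x_n}$). For a divisor $E$ defined at $p$ by a reduced equation $f=0$, the module of germs of logarithmic derivations along $E$ is $\operatorname{Der}_{S,p}(\log E)=\{\delta\in\operatorname{Der}_{S,p}:\delta(f)\in(f)\}$. Splayed: $(D,p)=(D_1,p)\cup(D_2,p)$ is splayed at $p$ (with splayed components $D_1,D_2$) if there exist complex coordinates $(x_1,\dots,x_n)$ at $p$ and an integer $1\le k\le n-1$ such that $D$ is defined by $h_1(x_1,\dots,x_k)\,h_2(x_{k+1},\dots,x_n)$, where $h_i$ is a reduced defining equation of $D_i$ at $p$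 ($i=1,2$; the $h_i$ need not be irreducible). *)

(* Defs.v *)
From HB Require Import structures.
From mathcomp Require Import all_boot all_order all_algebra.
From mathcomp Require Import boolp classical_sets reals complex.
From mathcomp Require Import mpoly.

Set Implicit Arguments.
Unset Strict Implicit.
Unset Printing Implicit Defensive.

Import Order.TTheory GRing.Theory Num.Theory.
Local Open Scope ring_scope.

(* Formal power series in n variables, as coefficient functions on the
   monomials 'X_{1..n}; [mdeg m] is the total degree |m|. *)
Record fps (K : Type) (n : nat) := FPS { fps_coef :> 'X_{1..n} -> K }.

Lemma fpsP (K : Type) n (f g : fps K n) : (forall m, f m = g m) <-> f = g.
Proof.
split=> [|->//]; case: f => f; case: g => g /= fg.
by congr FPS; apply/funext.
Qed.

HB.instance Definition _ (K : Type) n := gen_eqMixin (fps K n).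
HB.instance Definition _ (K : Type) n := gen_choiceMixin (fps K n).

Section FpsRing.
Variables (K : comNzRingType) (n : nat).
Implicit Types f g h : fps K n.

Definition fps_zero : fps K n := FPS (fun=> 0).
Definition fps_one : fps K n := FPS (fun m => (m == 0%MM)%:R).
Definition fps_opp f : fps K n := FPS (fun m => - f m).
Definition fps_add f g : fps K n := FPS (fun m => f m + g m).
Definition fps_mul f g : fps K n := FPS (fun m =>
  \sum_(k : 'X_{1..n < (mdeg m).+1, (mdeg m).+1} | m == (k.1 + k.2)%MM)
    f k.1 * g k.2).

Fact fps_addA : associative fps_add.
Proof. by move=> f g h; apply/fpsP => m /=; rewrite addrA. Qed.
Fact fps_addC : commutative fps_add.
Proof. by move=> f g; apply/fpsP => m /=; rewrite addrC. Qed.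
Fact fps_add0 : left_id fps_zero fps_add.
Proof. by move=> f; apply/fpsP => m /=; rewrite add0r. Qed.
Fact fps_addN : left_inverse fps_zero fps_opp fps_add.
Proof. by move=> f; apply/fpsP => m /=; rewrite addNr. Qed.

HB.instance Definition _ :=
  GRing.isZmodule.Build (fps K n) fps_addA fps_addC fps_add0 fps_addN.

(* The polynomial of the terms of f of degree < d. *)
Definition fps_trunc d f : {mpoly K[n]} :=
  \sum_(m : 'X_{1..n < d}) f m *: 'X_[m].

Lemma mcoeff_trunc d f m : (mdeg m < d)%N -> (fps_trunc d f)@_m = f m.
Proof. exact: mcoeff_mpoly. Qed.

Lemma mcoeffM_congr (p p' q q' : {mpoly K[n]}) m :
  (forall k, (mdeg k <= mdeg m)%N -> p@_k = p'@_k) ->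
  (forall k, (mdeg k <= mdeg m)%N -> q@_k = q'@_k) ->
  (p * q)@_m = (p' * q')@_m.
Proof.
move=> pp' qq'; rewrite !mcoeffM; apply: eq_bigr => k _.
by rewrite pp' ?qq' // -ltnS bmdeg.
Qed.

Lemma fps_mulE d f g m : (mdeg m < d)%N ->
  fps_mul f g m = (fps_trunc d f * fps_trunc d g)@_m.
Proof.
move=> md; rewrite mcoeffM /=; apply: eq_bigr => k _.
by rewrite !mcoeff_trunc //; apply: leq_trans (bmdeg _) _.
Qed.

Fact fps_mulA : associative fps_mul.
Proof.
move=> f g h; apply/fpsP => m; have lt_m := ltnSn (mdeg m).
pose t := fps_trunc (mdeg m).+1.
have tM u v k : (mdeg k <= mdeg m)%N -> (t (fps_mul u v))@_k = (t u * t v)@_k.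
  by move=> km; rewrite mcoeff_trunc // (fps_mulE _ _ (_ : _ < (mdeg m).+1)%N).
rewrite !(fps_mulE _ _ lt_m) -/t (@mcoeffM_congr _ (t f) _ (t g * t h)) //;
  last by move=> k; apply: tM.
rewrite mulrA; apply: mcoeffM_congr => // k km; exact/esym/tM.
Qed.

Fact fps_mulC : commutative fps_mul.
Proof.
by move=> f g; apply/fpsP => m; rewrite !(fps_mulE _ _ (ltnSn _)) mulrC.
Qed.

Fact fps_mul1 : left_id fps_one fps_mul.
Proof.
move=> f; apply/fpsP => m; rewrite (fps_mulE _ _ (ltnSn _)).
rewrite (@mcoeffM_congr _ 1 _ (fps_trunc (mdeg m).+1 f)) //.
  by rewrite mul1r mcoeff_trunc.
by move=> k km; rewrite mcoeff_trunc //= mcoeff1.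
Qed.

Fact fps_mulDl : left_distributive fps_mul fps_add.
Proof.
move=> f g h; apply/fpsP => m /=; rewrite -big_split /=.
by apply: eq_bigr => k _; rewrite mulrDl.
Qed.

Fact fps_one_neq0 : fps_one != 0.
Proof.
apply/eqP => /fpsP /(_ 0%MM) /= /eqP.
by rewrite eqxx oner_eq0.
Qed.

HB.instance Definition _ := GRing.Zmodule_isComNzRing.Build (fps K n)
  fps_mulA fps_mulC fps_mul1 fps_mulDl fps_one_neq0.

Lemma fps_coef0 m : (0 : fps K n) m = 0. Proof. by []. Qed.
Lemma fps_coef1 m : (1 : fps K n) m = (m == 0%MM)%:R. Proof. by []. Qed.
Lemma fps_coefN f m : (- f) m = - f m. Proof. by []. Qed.
Lemma fps_coefD f g m : (f + g) m = f m + g m. Proof. by []. Qed.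
Lemma fps_coefB f g m : (f - g) m = f m - g m. Proof. by []. Qed.
Lemma fps_coefM d f g m : (mdeg m < d)%N ->
  (f * g) m = \sum_(k : 'X_{1..n < d, d} | m == (k.1 + k.2)%MM)
                f k.1 * g k.2.
Proof.
move=> md; rewrite [LHS](fps_mulE _ _ md) (mcoeff_poly_mul _ _ md).
by apply: eq_bigr => k _; rewrite !mcoeff_trunc ?bmdeg.
Qed.

Definition fps_var (i : 'I_n) : fps K n := FPS (fun m => (m == U_(i)%MM)%:R).

Definition fps_deriv (i : 'I_n) f : fps K n :=
  FPS (fun m => f (m + U_(i))%MM *+ (m i).+1).

End FpsRing.

(* Substitution F(u_1, ..., u_k).  When the constant terms of the u_i vanish,
   only the monomials of F of degree <= |m| contribute to the coefficient at m,
   so the sum below is the full one; the definition is meant to be used only in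
   that case. *)
Definition fps_comp (K : comNzRingType) k n (F : fps K k)
    (u : 'I_k -> fps K n) : fps K n :=
  FPS (fun m => \sum_(b : 'X_{1..k < (mdeg m).+1})
                  F b * (\prod_i u i ^+ bmnm b i) m).

Section Convergent.
Variables (K : numFieldType) (n : nat).
Implicit Types f g : fps K n.

Definition fps_psum f (r : K) d : K :=
  \sum_(m : 'X_{1..n < d}) `|f m| * r ^+ mdeg m.

(* Absolute convergence on some closed polydisc of positive radius: the
   partial sums of the nonnegative series sum_m |f_m| r^|m| are bounded. *)
Definition convergent : {pred fps K n} :=
  [pred f | `[< exists r M : K, 0 < r /\ forall d, fps_psum f r d <= M >]].

Lemma sumr_le1 (I : finType) (P : pred I) (x : K) : 0 <= x ->
  {in P &, forall i j, i = j} -> \sum_(i | P i) x <= x.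
Proof.
move=> x0 P1; case: (pickP P) => [i Pi|P0]; last by rewrite big_pred0.
rewrite (bigD1 i) //= big1 ?addr0 // => j /andP[Pj].
by rewrite (P1 j i) // eqxx.
Qed.

Lemma fps_psum_le f (r s : K) d : 0 <= r -> r <= s ->
  fps_psum f r d <= fps_psum f s d.
Proof.
move=> r0 rs; apply: ler_sum => m _; apply: ler_wpM2l => //.
by apply: lerXn2r => //; rewrite nnegrE // (le_trans r0).
Qed.

Lemma fps_psum_ge0 f (r : K) d : 0 <= r -> 0 <= fps_psum f r d.
Proof. by move=> r0; apply: sumr_ge0 => m _; rewrite mulr_ge0 ?exprn_ge0. Qed.

Lemma convergent_common f g : f \in convergent -> g \in convergent ->
  exists r M N : K, [/\ 0 < r, forall d, fps_psum f r d <= M &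
                     forall d, fps_psum g r d <= N].
Proof.
move=> /asboolP[r [M [r0 fM]]] /asboolP[s [N [s0 gN]]].
have rs0 : 0 < r + s by rewrite addr_gt0.
have t0 : 0 < r * s / (r + s) by rewrite divr_gt0 ?mulr_gt0.
exists (r * s / (r + s)), M, N; split=> // d.
- apply: le_trans (fM d); apply: fps_psum_le; first exact: ltW.
  by rewrite ler_pdivrMr // ler_wpM2l ?ltW // ltrDr.
- apply: le_trans (gN d); apply: fps_psum_le; first exact: ltW.
  by rewrite ler_pdivrMr // mulrC ler_wpM2l ?ltW // ltrDl.
Qed.

Lemma fps_psumM f g (r : K) d : 0 <= r ->
  fps_psum (f * g) r d <= fps_psum f r d * fps_psum g r d.
Proof.
move=> r0; pose G (k : 'X_{1..n < d} * 'X_{1..n < d}) :=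
  `|f k.1| * r ^+ mdeg k.1 * (`|g k.2| * r ^+ mdeg k.2).
have G0 k : 0 <= G k by rewrite !mulr_ge0 ?exprn_ge0.
have -> : fps_psum f r d * fps_psum g r d = \sum_k G k.
  by rewrite /fps_psum big_distrlr /= pair_bigA.
apply: (@le_trans _ _ (\sum_(m : 'X_{1..n < d})
          \sum_(k : 'X_{1..n < d} * 'X_{1..n < d} |
                 bmnm m == (k.1 + k.2)%MM) G k)).
  apply: ler_sum => m _; rewrite (fps_coefM f g (bmdeg m)).
  apply: le_trans (ler_wpM2r _ (ler_norm_sum _ _ _)) _; first exact: exprn_ge0.
  rewrite mulr_suml; apply: ler_sum => k /eqP ->.
  by rewrite mdegD exprD normrM /G mulrACA.
rewrite (exchange_big_dep xpredT) //=; apply: ler_sum => k _.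
apply: sumr_le1 (G0 k) _ => i j /eqP Ei /eqP Ej.
by apply: val_inj; rewrite /= Ei Ej.
Qed.

Fact convergent_subring : subring_closed convergent.
Proof.
split.
- apply/asboolP; exists 1, 1; split=> [|d]; first exact: ltr01.
  apply: (@le_trans _ _ (\sum_(m : 'X_{1..n < d} | bmnm m == 0%MM) 1)).
    rewrite big_mkcond; apply: ler_sum => m _.
    rewrite fps_coef1 expr1n mulr1.
    by case: eqP => _; rewrite ?normr1 ?normr0.
  apply: sumr_le1 => // i j /eqP Ei /eqP Ej.
  by apply: val_inj; rewrite /= Ei Ej.
- move=> f g fc gc; have [r [M [N [r0 fM gN]]]] := convergent_common fc gc.
  apply/asboolP; exists r, (M + N); split=> // d.
  apply: le_trans (lerD (fM d) (gN d)); rewrite /fps_psum -big_split /=.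
  apply: ler_sum => m _; rewrite -mulrDl; apply: ler_wpM2r (ler_normB _ _).
  exact/exprn_ge0/ltW.
- move=> f g fc gc; have [r [M [N [r0 fM gN]]]] := convergent_common fc gc.
  apply/asboolP; exists r, (M * N); split=> // d.
  apply: le_trans (fps_psumM _ _ _ (ltW r0)) _.
  by apply: ler_pM => //; apply/fps_psum_ge0/ltW.
Qed.

HB.instance Definition _ :=
  GRing.isSubringClosed.Build (fps K n) convergent convergent_subring.

Lemma convergent_deriv i f :
  f \in convergent -> fps_deriv i f \in convergent.
Proof.
move=> /asboolP[r [M [r0 fM]]]; have r20 : 0 < r / 2 by rewrite divr_gt0.
apply/asboolP; exists (r / 2), (r^-1 * M); split=> // d.
pose G (m : 'X_{1..n}) := `|f m| * r ^+ mdeg m.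
have G0 m : 0 <= G m by rewrite mulr_ge0 ?exprn_ge0 // ltW.
apply: (@le_trans _ _ (\sum_(m : 'X_{1..n < d}) r^-1 * G (m + U_(i))%MM)).
  apply: ler_sum => m _; rewrite /G mdegD mdeg1 addn1 exprS mulrCA mulKf ?gt_eqF //.
  rewrite normrMn mulrnAl -mulrnAr; apply: ler_wpM2l => //.
  rewrite -[_ *+ (m i).+1]mulr_natr expr_div_n -mulrA; apply: ler_piMr; first exact/exprn_ge0/ltW.
  rewrite mulrC ler_pdivrMr ?exprn_gt0 // mul1r -natrX ler_nat.
  apply: leq_trans (ltn_expl (mdeg m) _) => //; rewrite ltnS mdegE (bigD1 i) //=.
  exact: leq_addr.
rewrite -mulr_sumr ler_pM2l ?invr_gt0 //; apply: le_trans (fM d.+1).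
have lt_d (m : 'X_{1..n < d}) : (mdeg (m + U_(i))%MM < d.+1)%N.
  by rewrite mdegD mdeg1 addn1 ltnS bmdeg.
rewrite (eq_bigr (fun m : 'X_{1..n < d} => \sum_(k : 'X_{1..n < d.+1} |
    k == BMultinom (lt_d m)) G k)) => [|m _]; last by rewrite big_pred1_eq.
rewrite (exchange_big_dep xpredT) //=; apply: ler_sum => k _.
apply: sumr_le1 (G0 k) _ => a b /eqP Ea /eqP Eb; apply: val_inj.
by have /(congr1 val)/= := etrans (esym Ea) Eb; apply: addIm.
Qed.

End Convergent.

(* The ring K{x_1, ..., x_n}: for K = C, the local ring O_{S,p} of germs of
   holomorphic functions, in coordinates centred at p. *)
Record cps (K : numFieldType) (n : nat) :=
  CPS { cps_val :> fps K n; cps_valP : cps_val \in @convergent K n }.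

Section CpsRing.
Variables (K : numFieldType) (n : nat).

HB.instance Definition _ := [isSub for @cps_val K n].
HB.instance Definition _ := [Choice of cps K n by <:].
HB.instance Definition _ := [SubChoice_isSubComNzRing of cps K n by <:].

Definition cps_unit : {pred cps K n} := [pred f | `[< exists g, g * f = 1 >]].
Definition cps_inv (f : cps K n) : cps K n :=
  if pselect (exists g, g * f = 1) is left fU then projT1 (cid fU) else f.

Fact cps_mulVr : {in cps_unit, left_inverse 1 cps_inv *%R}.
Proof.
move=> f /asboolP fU; rewrite /cps_inv; case: pselect => // fU'.
by case: cid.
Qed.
Fact cps_unitP (f g : cps K n) : g * f = 1 -> f \in cps_unit.
Proof. by move=> gf; apply/asboolP; exists g. Qed.
Fact cps_inv_out : {in [predC cps_unit], cps_inv =1 id}.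
Proof. by move=> f /asboolPn fN; rewrite /cps_inv; case: pselect. Qed.

HB.instance Definition _ := GRing.ComNzRing_hasMulInverse.Build (cps K n)
  cps_mulVr cps_unitP cps_inv_out.

End CpsRing.

Section Splayed.
Local Open Scope classical_set_scope.
Variables (K : numFieldType) (n : nat).
Local Notation O := (cps K n).
Implicit Types (f g h : O) (D : set O).

Definition partial (i : 'I_n) f : O := CPS (convergent_deriv i (cps_valP f)).

Definition divides f g := exists a, g = a * f.

(* The ideal (f).  The divisor germ {f = 0}, as a germ of complex space, is
   represented by the ideal of its defining equations. *)
Definition ideal f : set O := [set q | divides f q].

Definition no_common_factor f g :=
  forall q, divides q f -> divides q g -> q \is a GRing.unit.

Definition reduced f := forall q, divides (q ^+ 2) f -> q \is a GRing.unit.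

Definition reduced_equation f D := reduced f /\ D = ideal f.

(* A germ of vector field sum_i d_i * partial_i is its row of coefficients, so
   that Der is the free module 'rV[O]_n. *)
Definition apply_der (d : 'rV[O]_n) f : O := \sum_i d 0 i * partial i f.

Definition der_log f : set 'rV[O]_n := [set d | ideal f (apply_der d f)].

(* The y_i are the components of a germ of biholomorphic map
   (C^n, 0) -> (C^n, 0), the z_i being those of the inverse germ. *)
Definition coordinates (y : 'I_n -> O) :=
  (forall i, y i 0%MM = 0) /\
  exists z : 'I_n -> O,
    [/\ forall i, z i 0%MM = 0,
        forall i, fps_comp (y i) (fun j => cps_val (z j)) = fps_var K i &
        forall i, fps_comp (z i) (fun j => cps_val (y j)) = fps_var K i].

(* n = k + l with k, l >= 1; the coordinates y_1, ..., y_k are indexed by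
   [lshift l i] and y_(k+1), ..., y_n by [rshift k j]. *)
Definition splayed D D1 D2 :=
  exists y, coordinates y /\
  exists k l (kl : (k + l)%N = n), [/\ (0 < k)%N, (0 < l)%N &
  exists (H1 : cps K k) (H2 : cps K l) (h1 h2 : O),
    [/\ cps_val h1 = fps_comp H1 (fun i => cps_val (y (cast_ord kl (lshift l i)))),
        cps_val h2 = fps_comp H2 (fun j => cps_val (y (cast_ord kl (rshift k j)))),
        reduced_equation h1 D1, reduced_equation h2 D2 &
        D = ideal (h1 * h2)]].

End Splayed.

(* Main.v *)
(* If D = {h1(y_1..y_k) h2(y_(k+1)..y_n) = 0}, a vector field is the sum of its
   components along the two blocks of coordinates, and each of them kills one
   of h1, h2.

   Conversely, write the constant fields as sums of fields in Der(log g) and in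
   Der(log h).  At the origin this gives a basis of C^n made of values of
   fields of Der(log h) for the first k vectors, and of Der(log g) for the
   others.  By Rossi's argument a field of Der(log g) which does not vanish at
   the origin can be straightened: with delta t = 1 and delta g = a g, one has
   g = u exp(- t delta) g, where u = exp(- t (delta - a)) 1 is a unit, and
   exp(- t delta) g is constant along the flow of delta.  Doing this n - k times
   shows that, up to a unit, g depends only on k functions w_i, whose
   differentials at 0 are dual to the first k vectors of the basis; similarly h
   depends on n - k functions v_j.  Together the w_i and v_j are coordinates.

   All convergence questions (the exponentials, the inverse change of
   coordinates) reduce to one estimate: a product of N first-order operators
   applied to a convergent series is bounded on a smaller polydisc by
   M R^N N!. *)

Require Import Defs.
From HB Require Import structures.
From mathcomp Require Import all_boot all_order all_algebra.
From mathcomp Require Import boolp classical_sets reals complex.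
From mathcomp Require Import mpoly ring.

Set Implicit Arguments.
Unset Strict Implicit.
Unset Printing Implicit Defensive.

Import Order.TTheory GRing.Theory Num.Theory.
Local Open Scope ring_scope.

(** * Formal power series and substitution *)

Section Order.
Variables (K : comNzRingType) (n : nat).
Implicit Types f g : fps K n.

(** Membership in the [d]-th power of the maximal ideal; (x)-adic limits are expressed through this
    filtration. *)
Definition ord d f := forall m, (mdeg m < d)%N -> f m = 0.

Lemma ord_le d e f : (d <= e)%N -> ord e f -> ord d f.
Proof. by move=> de fe m md; apply: fe; apply: leq_trans de. Qed.
Lemma ordD d f g : ord d f -> ord d g -> ord d (f + g).
Proof. by move=> fd gd m md; rewrite fps_coefD fd // gd // addr0. Qed.
Lemma ordN d f : ord d f -> ord d (- f).
Proof. by move=> fd m md; rewrite fps_coefN fd // oppr0. Qed.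
Lemma ordB d f g : ord d f -> ord d g -> ord d (f - g).
Proof. by move=> fd gd; apply: ordD => //; apply: ordN. Qed.
Lemma ord_sum I (r : seq I) (P : pred I) d (F : I -> fps K n) :
  (forall i, P i -> ord d (F i)) -> ord d (\sum_(i <- r | P i) F i).
Proof. by move=> Fd; apply: big_ind => //; apply: ordD. Qed.
Lemma ordM d e f g : ord d f -> ord e g -> ord (d + e) (f * g).
Proof.
move=> fd ge m md; rewrite (fps_coefM _ _ (ltnSn _)) big1 // =>
  k /eqP /(congr1 (@mdeg _)).
rewrite mdegD => mk; have [kd|kd] := ltnP (mdeg k.1) d;
  first by rewrite fd ?mul0r.
rewrite ge ?mulr0 // -(ltn_add2l d); rewrite mk in md; apply: leq_ltn_trans md.
by rewrite leq_add2r.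
Qed.
Lemma ordMl d f g : ord d g -> ord d (f * g).
Proof. by move=> gd; apply: (@ordM 0 d). Qed.
Lemma ordMr d f g : ord d f -> ord d (f * g).
Proof. by rewrite mulrC; exact: ordMl. Qed.
Lemma ordX k f : f 0%MM = 0 -> ord k (f ^+ k).
Proof.
move=> f0; have f1 : ord 1 f by move=> m; rewrite ltnS leqn0 mdeg_eq0 => /eqP->.
by elim: k => // k IH; rewrite exprS; exact: (@ordM 1 k).
Qed.
Lemma ord_eq0 f : (forall d, ord d f) -> f = 0.
Proof. by move=> fd; apply/fpsP => m; apply: (fd (mdeg m).+1). Qed.

Lemma fps_coef0M f g : (f * g) 0%MM = f 0%MM * g 0%MM.
Proof.
have d0 : (mdeg (0 : 'X_{1..n})%MM < 1)%N by rewrite mdeg0.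
rewrite (fps_coefM _ _ d0) (bigD1 (BMultinom d0, BMultinom d0)) /=; last first.
  by rewrite addm0.
rewrite big1 ?addr0 // => -[a b] /andP[_].
case/negP; apply/eqP; congr pair; apply: val_inj => /=; apply/eqP;
  by rewrite -mdeg_eq0 -leqn0 -ltnS bmdeg.
Qed.

Lemma fps_coef_sum I (r : seq I) (P : pred I) (F : I -> fps K n) m :
  (\sum_(i <- r | P i) F i) m = \sum_(i <- r | P i) F i m.
Proof. by elim/big_ind2: _ => // f x g y <- <-. Qed.

Definition fps_mon (c : K) (a : 'X_{1..n}) : fps K n :=
  FPS (fun m => c *+ (m == a)).
Definition fps_cst c := fps_mon c 0%MM.

Lemma fps_mon_coef c a m : fps_mon c a m = c *+ (m == a). Proof. by []. Qed.

Lemma fps_monM c a c' a' :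
  fps_mon c a * fps_mon c' a' = fps_mon (c * c') (a + a').
Proof.
apply/fpsP => m; pose d := (maxn (mdeg m) (maxn (mdeg a) (mdeg a'))).+1.
have dm : (mdeg m < d)%N by rewrite ltnS leq_maxl.
have da : (mdeg a < d)%N by rewrite ltnS !leq_max leqnn !orbT.
have da' : (mdeg a' < d)%N by rewrite ltnS !leq_max leqnn !orbT.
rewrite (fps_coefM _ _ dm) big_mkcond (bigD1 (BMultinom da, BMultinom da')) //=.
rewrite big1 ?addr0 /=; last first.
  move=> [k l]; rewrite xpair_eqE negb_and -(inj_eq val_inj k).
  rewrite -(inj_eq val_inj l) /= => kl; case: ifP => // _.
  by case/orP: kl => /negbTE ->; rewrite ?mulr0n ?mulr0 ?mul0r.
by rewrite !eqxx; case: eqP; rewrite /= ?mulr1n.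
Qed.

Lemma fps_cst_is_zmod_morphism : zmod_morphism fps_cst.
Proof. by move=> a b; apply/fpsP => m; rewrite fps_coefB !fps_mon_coef mulrnBl.
Qed.
Lemma fps_cst_is_monoid_morphism : monoid_morphism fps_cst.
Proof.
split; first by apply/fpsP => m.
by move=> a b; rewrite fps_monM addm0.
Qed.
HB.instance Definition _ := GRing.isZmodMorphism.Build K (fps K n) fps_cst
  fps_cst_is_zmod_morphism.
HB.instance Definition _ := GRing.isMonoidMorphism.Build K (fps K n) fps_cst
  fps_cst_is_monoid_morphism.

Lemma fps_cst0 c : fps_cst c 0%MM = c.
Proof. by rewrite /= eqxx. Qed.

Lemma fps_cstM c f m : (fps_cst c * f) m = c * f m.
Proof.
have d0 : (mdeg (0%MM : 'X_{1..n}) < (mdeg m).+1)%N by rewrite mdeg0.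
rewrite (fps_coefM _ _ (ltnSn _)) big_mkcond (bigD1 (BMultinom d0, BMultinom
  (ltnSn _))) //=.
rewrite add0m !eqxx big1 ?addr0 // => -[k l] kl; case: ifP => // /eqP /= mkl.
case: eqP => [k0|_]; rewrite ?mul0r //.
case/negP: kl; apply/eqP; congr pair; apply: val_inj => //=.
by rewrite k0 add0m in mkl.
Qed.

Lemma fps_varX i k : fps_var K i ^+ k = fps_mon 1 (U_(i) *+ k)%MM.
Proof.
elim: k => [|k IH]; first by rewrite expr0 mulm0n; apply/fpsP.
have -> : fps_var K i = fps_mon 1 U_(i) by apply/fpsP.
by rewrite exprS IH fps_monM mulr1 mulmS.
Qed.

Lemma fps_monE c a : fps_mon c a = fps_cst c * \prod_i fps_var K i ^+ a i.
Proof.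
transitivity (fps_cst c * fps_mon 1 (\sum_i U_(i) *+ a i)%MM).
  by rewrite fps_monM add0m mulr1 -multinomUE_id.
congr (_ * _); symmetry.
apply: (big_rec2 (fun x y => x = fps_mon 1 y)); first by apply/fpsP.
by move=> i x y _ ->; rewrite fps_varX fps_monM mulr1.
Qed.

Lemma fps_approx d f :
  ord d (f - \sum_(m : 'X_{1..n < d}) fps_mon (f m) m).
Proof.
move=> m md; rewrite fps_coefB fps_coef_sum (bigD1 (BMultinom md)) //=.
rewrite eqxx mulr1n big1 ?addr0 ?subrr // => k km.
by case: eqP => // E; case/negP: km; apply/eqP/val_inj.
Qed.

Lemma fps_deriv_additive i : zmod_morphism (@fps_deriv K n i).
Proof. by move=> f g; apply/fpsP => m /=; rewrite mulrnBl. Qed.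
HB.instance Definition _ i := GRing.isZmodMorphism.Build (fps K n) (fps K n)
  (@fps_deriv K n i) (fps_deriv_additive i).

Lemma fps_derivM i f g :
  fps_deriv i (f * g) = fps_deriv i f * g + f * fps_deriv i g.
Proof.
apply/fpsP => m.
rewrite -[LHS]/((f * g) (m + U_(i))%MM *+ (m i).+1) fps_coefD.
have md : (mdeg (m + U_(i)) < (mdeg m).+2)%N by rewrite mdegD mdeg1 addn1.
rewrite [(f * g) _](fps_mulE _ _ md) -mcoeff_deriv mderivM mcoeffD;
  congr (_ + _).
  rewrite [RHS](fps_mulE _ _ (ltnSn _)).
  apply: mcoeffM_congr => k km; rewrite ?mcoeff_deriv !mcoeff_trunc //.
  - by rewrite mdegD mdeg1 addn1 !ltnS.
  - by rewrite !ltnS leqW.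
rewrite [RHS](fps_mulE _ _ (ltnSn _)).
apply: mcoeffM_congr => k km; rewrite ?mcoeff_deriv !mcoeff_trunc //.
- by rewrite !ltnS leqW.
- by rewrite mdegD mdeg1 addn1 !ltnS.
Qed.

Lemma fps_derivC i j f :
  fps_deriv i (fps_deriv j f) = fps_deriv j (fps_deriv i f).
Proof.
have [->//|ij] := eqVneq i j; apply/fpsP => m /=.
rewrite -!mulrnA !mnmDE !mnm1E [j == i]eq_sym (negbTE ij) !addn0.
by rewrite mulnC -!addmA [(U_(i) + _)%MM]addmC.
Qed.

Lemma fps_deriv_cst i c : fps_deriv i (fps_cst c) = 0.
Proof.
apply/fpsP => m /=; case: eqP => [/mnmP/(_ i)|]; rewrite ?mul0rn //.
by rewrite mnmDE mnm1E eqxx mnmE addn1.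
Qed.

Lemma fps_deriv_var (i j : 'I_n) : fps_deriv i (fps_var K j) = (i == j)%:R.
Proof.
have [<-|ij] := eqVneq i j; apply/fpsP => m.
  rewrite mulr1n fps_coef1 /= -[X in _ == X](add0m U_(i)%MM) eqm_add2r.
  by case: eqP => [->|_]; rewrite ?mnmE ?mul0rn.
rewrite mulr0n /=; case: eqP => [/mnmP/(_ i)|]; rewrite ?mul0rn //.
by rewrite mnmDE !mnm1E eqxx eq_sym (negbTE ij) addn1.
Qed.

Lemma ord_deriv d i f : ord d.+1 f -> ord d (fps_deriv i f).
Proof. by move=> fd m md /=; rewrite fd ?mul0rn // mdegD mdeg1 addn1. Qed.

Lemma fps_derivX i f k :
  fps_deriv i (f ^+ k.+1) = k.+1%:R * f ^+ k * fps_deriv i f.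
Proof.
elim: k => [|k IH]; first by rewrite expr1 expr0 !mul1r.
rewrite exprS fps_derivM IH -[in RHS]natr1 !mulrDl mul1r addrC; congr (_ + _).
  by rewrite [in RHS]exprS !mulrA [f * _]mulrC.
by rewrite mulrC.
Qed.

End Order.

Section Dense.
Variable K : comNzRingType.

(* Continuity for the (x)-adic topology is allowed a loss of [c] degrees. *)
Lemma fps_dense k n c (T : fps K k -> fps K n) :
  zmod_morphism T -> (forall d f, ord (d + c) f -> ord d (T f)) ->
  (forall a m, T (fps_mon a m) = 0) -> forall f, T f = 0.
Proof.
move=> Tadd Tc T0 f; apply: ord_eq0 => d.
pose T' : {additive fps K k -> fps K n} :=
  HB.pack T (GRing.isZmodMorphism.Build _ _ T Tadd).
have := Tc _ _ (fps_approx f (d:=(d + c)%N)).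
by rewrite Tadd [T (\sum_(_ | _) _)](raddf_sum T') /= big1 ?subr0.
Qed.

Variables k n : nat.
Implicit Types (F G : fps K k) (u : 'I_k -> fps K n).

(** A monomial of degree above [mdeg m] in series without constant term has zero coefficient at [m],
    so every larger cutoff gives the same sum. *)
Lemma fps_comp_coef d F u m : (forall i, u i 0%MM = 0) -> (mdeg m < d)%N ->
  fps_comp F u m = \sum_(b : 'X_{1..k < d}) F b * (\prod_i u i ^+ bmnm b i) m.
Proof.
move=> u0 md; rewrite /fps_comp /=.
pose G (b : 'X_{1..k}) := F b * (\prod_i u i ^+ b i) m.
have G0 b : (mdeg m < mdeg b)%N -> G b = 0.
  move=> mb; rewrite /G; suff -> : (\prod_i u i ^+ b i) m = 0 by rewrite mulr0.
  suff: ord (mdeg b) (\prod_i u i ^+ b i) by apply.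
  rewrite mdegE; apply: (big_ind2 (fun x y => ord x y)) => //.
    by move=> *; apply: ordM.
  by move=> i _; apply: ordX.
rewrite -/(G _).
have E e : (mdeg m < e)%N -> \sum_(b : 'X_{1..k < e}) G b =
    \sum_(b : 'X_{1..k < (mdeg m).+1}) G b.
  move=> me.
  rewrite (bigID (fun b : 'X_{1..k < e} => (mdeg b < (mdeg m).+1)%N)) /=.
  rewrite [X in _ + X]big1 ?addr0; last by move=> b; rewrite -leqNgt => /G0.
  have wid (b : 'X_{1..k < (mdeg m).+1}) : (mdeg b < e)%N.
    exact: leq_trans (bmdeg b) me.
  have m0 : (mdeg (0%MM : 'X_{1..k}) < (mdeg m).+1)%N by rewrite mdeg0.
  rewrite (reindex_onto (fun b : 'X_{1..k < (mdeg m).+1} => BMultinom (wid b))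
    (fun b : 'X_{1..k < e} => insubd (BMultinom m0) (bmnm b))) /=.
    apply: eq_big => // b; rewrite bmdeg; apply/eqP/val_inj.
    by rewrite val_insubd bmdeg.
  by move=> b bm; apply: val_inj; rewrite /= val_insubd bm.
by rewrite (E _ md).
Qed.

Lemma fps_comp_additive u : zmod_morphism (fun F => fps_comp F u).
Proof.
move=> F G; apply/fpsP => m; rewrite fps_coefB /= -sumrB.
by apply: eq_bigr => b _; rewrite mulrBl.
Qed.

Lemma fps_comp_mon u a b : (forall i, u i 0%MM = 0) ->
  fps_comp (fps_mon a b) u = fps_cst n a * \prod_i u i ^+ b i.
Proof.
move=> u0; apply/fpsP => m; rewrite fps_cstM.
pose d := (maxn (mdeg m) (mdeg b)).+1.
have dm : (mdeg m < d)%N by rewrite ltnS leq_maxl.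
have db : (mdeg b < d)%N by rewrite ltnS leq_maxr.
rewrite (fps_comp_coef _ u0 dm) (bigD1 (BMultinom db)) //= eqxx mulr1n.
rewrite [X in _ + X]big1 ?addr0 // => c cb; case: eqP => [E|_];
  last by rewrite mul0r.
by case/negP: cb; apply/eqP/val_inj.
Qed.

Lemma fps_comp_ord u d F : (forall i, u i 0%MM = 0) -> ord d F ->
  ord d (fps_comp F u).
Proof.
move=> u0 Fd m md; rewrite (fps_comp_coef _ u0 md) big1 // => b _.
by rewrite Fd ?mul0r ?bmdeg.
Qed.
End Dense.

Lemma subrACA (V : zmodType) (a b c d : V) : a - b - (c - d) = a - c - (b - d).
Proof. by rewrite !opprB addrACA [RHS]addrACA [- b + _]addrC. Qed.

(** * Substitution as a continuous algebra morphism *)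

Section Composition.
Variable K : comNzRingType.

Lemma fps_varE n i : fps_var K i = fps_mon 1 U_(i) :> fps K n.
Proof. by apply/fpsP. Qed.

Section Fixed.
Variables (k n : nat) (u : 'I_k -> fps K n).
Hypothesis u0 : forall i, u i 0%MM = 0.
Implicit Types F G : fps K k.

Lemma fps_comp_cst a : fps_comp (fps_cst k a) u = fps_cst n a.
Proof.
by rewrite fps_comp_mon // big1 ?mulr1 // => i _; rewrite mnm0E expr0.
Qed.

Lemma fps_comp_var i : fps_comp (fps_var K i) u = u i.
Proof.
rewrite fps_varE fps_comp_mon // rmorph1 mul1r (bigD1 i) //= mnm1E eqxx expr1.
by rewrite big1 ?mulr1 // => j ji; rewrite mnm1E eq_sym (negbTE ji) expr0.
Qed.

Lemma fps_compB F G :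
  fps_comp (F - G) u = fps_comp F u - fps_comp G u.
Proof. exact: fps_comp_additive. Qed.

Lemma fps_comp_0 : fps_comp 0 u = 0.
Proof. by rewrite -(subrr 0) fps_compB subrr. Qed.

Lemma fps_compD F G :
  fps_comp (F + G) u = fps_comp F u + fps_comp G u.
Proof.
by apply: (addIr (- fps_comp G u)); rewrite -fps_compB !addrK.
Qed.

(** With one argument fixed, the defect is additive and continuous in the other; density, used in
    [F] and then in [G], leaves only monomials to check. *)
Lemma fps_compM F G :
  fps_comp (F * G) u = fps_comp F u * fps_comp G u.
Proof.
have zm (H : fps K k) : zmod_morphism
    (fun F => fps_comp (F * H) u - fps_comp F u * fps_comp H u).
  by move=> f g; rewrite mulrBl !fps_compB mulrBl subrACA.
apply/eqP; rewrite -subr_eq0; apply/eqP.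
apply: (fps_dense (c := 0) (zm G)) F => [d F|a m].
  rewrite addn0 => Fd; apply: ordB; last exact/ordMr/fps_comp_ord.
  exact/fps_comp_ord/ordMr.
rewrite mulrC [X in _ - X]mulrC.
apply: (fps_dense (c := 0) (zm _)) G => [d G|b l].
  rewrite addn0 => Gd; apply: ordB; last exact/ordMr/fps_comp_ord.
  exact/fps_comp_ord/ordMr.
rewrite fps_monM !fps_comp_mon // rmorphM /= mulrACA -big_split /=.
by apply/eqP; rewrite subr_eq0; apply/eqP; congr (_ * _);
  apply: eq_bigr => i _; rewrite mnmDE exprD.
Qed.

Lemma fps_comp0 F : fps_comp F u 0%MM = F 0%MM.
Proof.
pose G := F - fps_cst k (F 0%MM).
have G1 : ord 1 G.
  move=> m; rewrite ltnS leqn0 mdeg_eq0 => /eqP ->.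
  by rewrite fps_coefB fps_cst0 subrr.
have -> : F = fps_cst k (F 0%MM) + G by rewrite addrC subrK.
rewrite fps_compD fps_comp_cst [LHS]fps_coefD [RHS]fps_coefD !fps_cst0.
by rewrite (fps_comp_ord u0 G1) ?G1 ?mdeg0.
Qed.

(** The defect [E] is additive, loses at most one degree, obeys a Leibniz rule and vanishes on
    constants and variables, hence on monomials. *)
Lemma fps_comp_deriv p F : fps_deriv p (fps_comp F u) =
  \sum_i fps_comp (fps_deriv i F) u * fps_deriv p (u i).
Proof.
pose E F := fps_deriv p (fps_comp F u) -
  \sum_i fps_comp (fps_deriv i F) u * fps_deriv p (u i).
suff: E F = 0 by move/eqP; rewrite subr_eq0 => /eqP.
have EM f g : E (f * g) = E f * fps_comp g u + fps_comp f u * E g.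
  rewrite /E fps_compM fps_derivM mulrBl mulrBr addrACA -opprD; congr (_ - _).
  rewrite mulr_suml mulr_sumr -big_split; apply: eq_bigr => i _ /=.
  rewrite fps_derivM fps_compD !fps_compM mulrDl; congr (_ + _).
    by rewrite -!mulrA [fps_comp g u * _]mulrC.
  by rewrite mulrA.
have Ecst a : E (fps_cst k a) = 0.
  rewrite /E fps_comp_cst fps_deriv_cst big1 ?subrr // => i _.
  by rewrite fps_deriv_cst fps_comp_0 mul0r.
have E1 : E 1 = 0 by rewrite -(rmorph1 (fps_cst k)) Ecst.
have Evar i : E (fps_var K i) = 0.
  rewrite /E fps_comp_var (bigD1 i) //= fps_deriv_var eqxx -(rmorph1 (fps_cst
    k)).
  rewrite fps_comp_cst rmorph1 mul1r big1 ?addr0 ?subrr // => j ji.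
  by rewrite fps_deriv_var (negbTE ji) fps_comp_0 mul0r.
apply: (fps_dense (c := 1)) F => [F G|d F Fd|a m].
- rewrite /E fps_compB raddfB subrACA; congr (_ - _).
  by rewrite -sumrB; apply: eq_bigr => i _; rewrite raddfB fps_compB mulrBl.
- rewrite addn1 in Fd; apply: ordB; first exact/ord_deriv/fps_comp_ord.
  by apply: ord_sum => i _; apply/ordMr/fps_comp_ord/ord_deriv.
- rewrite fps_monE EM Ecst mul0r add0r.
  suff -> : E (\prod_i fps_var K i ^+ m i) = 0 by rewrite mulr0.
  apply: (big_ind (fun f => E f = 0)) => // [f g Ef Eg|i _].
    by rewrite EM Ef Eg mul0r mulr0 addr0.
  by elim: (m i) => // j IH; rewrite exprS EM Evar IH mul0r mulr0 addr0.
Qed.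

End Fixed.

(** Both sides agree on monomials by multiplicativity, and monomials determine a continuous additive
    map. This lets exponentials of derivations be treated as substitutions. *)
Lemma fps_comp_uniq k n (T : fps K k -> fps K n) : zmod_morphism T ->
  {morph T : f g / f * g} -> (forall a, T (fps_cst k a) = fps_cst n a) ->
  (forall d f, ord d f -> ord d (T f)) ->
  forall f, T f = fps_comp f (fun i => T (fps_var K i)).
Proof.
move=> Tadd TM Tcst To f.
have u0 i : T (fps_var K i) 0%MM = 0.
  suff o1 : ord 1 (T (fps_var K i)) by apply: o1; rewrite mdeg0.
  apply: To => m; rewrite ltnS leqn0 mdeg_eq0 => /eqP -> /=.
  by case: eqP => // /mnmP/(_ i); rewrite mnm1E mnm0E eqxx.
apply/eqP; rewrite -subr_eq0; apply/eqP.
apply: (fps_dense (c := 0) (T := fun f => T f - fps_comp f _)) f =>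
  [f g|d f|a m].
- by rewrite Tadd fps_compB // subrACA.
- by rewrite addn0 => fd; apply: ordB; [apply: To|apply: fps_comp_ord].
- rewrite fps_comp_mon // fps_monE TM Tcst.
  have T1 : T 1 = 1 by rewrite -(rmorph1 (fps_cst k)) Tcst rmorph1.
  rewrite (big_morph T TM T1); apply/eqP; rewrite subr_eq0; apply/eqP.
  congr (_ * _); apply: eq_bigr => i _.
  by elim: (m i) => // j IH; rewrite !exprS TM IH.
Qed.

Lemma fps_comp_id n (F : fps K n) : fps_comp F (fun i => fps_var K i) = F.
Proof. by rewrite -(@fps_comp_uniq n n id). Qed.

Lemma fps_compA k l n (F : fps K k) (z : 'I_k -> fps K l) (y :
  'I_l -> fps K n) :
  (forall i, z i 0%MM = 0) -> (forall i, y i 0%MM = 0) ->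
  fps_comp (fps_comp F z) y = fps_comp F (fun i => fps_comp (z i) y).
Proof.
move=> z0 y0.
rewrite [LHS](@fps_comp_uniq k n (fun F => fps_comp (fps_comp F z) y)).
- by congr fps_comp; apply/funext => i; rewrite fps_comp_var.
- by move=> f g; rewrite !fps_compB.
- by move=> f g; rewrite !fps_compM.
- by move=> a; rewrite !fps_comp_cst.
- by move=> d f fd; do 2!apply: fps_comp_ord => //.
Qed.

End Composition.

(** * Summable families and first-order operators *)

Section Sums.
Variables (K : comNzRingType) (n : nat).
Implicit Types (f g : fps K n) (F G : nat -> fps K n).

(** When each [F k] has order [k], the terms left out vanish at [m], and this is the full infinite
    sum. *)
Definition fsum F : fps K n := FPS (fun m => \sum_(k < (mdeg m).+1) F k m).

Lemma fsum_coef F m : fsum F m = \sum_(k < (mdeg m).+1) F k m. Proof. by [].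
Qed.

Lemma fsum_approx d F : (forall k, ord k (F k)) ->
  ord d (fsum F - \sum_(k < d) F k).
Proof.
move=> Fo m md; rewrite fps_coefB fps_coef_sum /=.
rewrite (big_ord_widen d (fun k => F k m) md) [X in _ - X](bigID (fun k :
  'I_d => (k < (mdeg m).+1)%N)) /=.
rewrite [X in _ - (_ + X)]big1 ?addr0 ?subrr // => k; rewrite -leqNgt => mk.
exact: Fo.
Qed.

Lemma eq_ord f g : (forall d, ord d (f - g)) -> f = g.
Proof. by move=> fg; apply/eqP; rewrite -subr_eq0; apply/eqP/ord_eq0. Qed.

Lemma ord_trans d f g h : ord d (f - g) -> ord d (g - h) -> ord d (f - h).
Proof. by move=> fg gh; have := ordD fg gh; rewrite addrA subrK. Qed.

Lemma ord_sym d f g : ord d (f - g) -> ord d (g - f).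
Proof. by move=> fg; rewrite -opprB; apply: ordN. Qed.

Lemma ordBM d f f' g g' : ord d (f - f') -> ord d (g - g') ->
  ord d (f * g - f' * g').
Proof.
move=> ff' gg'; apply: (@ord_trans _ _ (f' * g)); rewrite -?mulrBr -?mulrBl.
  exact: ordMr.
exact: ordMl.
Qed.

Lemma fsumM F G : (forall k, ord k (F k)) -> (forall k, ord k (G k)) ->
  fsum F * fsum G = fsum (fun k => \sum_(i < k.+1) F i * G (k - i)%N).
Proof.
move=> Fo Go; apply: eq_ord => d.
apply: ord_trans (ordBM (fsum_approx (d:=d) Fo) (fsum_approx (d:=d) Go)) _.
apply: ord_trans (ord_sym (fsum_approx (d:=d) _)); last first.
  move=> k; apply: ord_sum => i _;
    rewrite -{1}(subnKC (ltn_ord i : (i <= k)%N)).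
  exact: ordM.
(* Partial sums become values at 1 of polynomials over the series ring, so that the Cauchy product
   is a product of polynomials. *)
pose p := \poly_(i < d) F i; pose q := \poly_(i < d) G i.
have E (H : nat -> fps K n) : \sum_(i < d) H i = (\poly_(i < d) H i :
  {poly fps K n}).[1].
  by rewrite horner_poly; apply: eq_bigr => i _; rewrite expr1n mulr1.
rewrite !E -/p -/q -hornerM (@horner_coef_wide _ (d + size (p * q))) ?leq_addl
  //.
rewrite big_split_ord /=.
set A := \sum_(i < d) _; set B := \sum_(i < size _) _; set C := \sum_(i < d) _.
have -> : A = C.
  apply: eq_bigr => i _; rewrite expr1n mulr1 coefM; apply: eq_bigr => j _.
  rewrite !coef_poly (leq_ltn_trans (leq_subr _ _) (ltn_ord i)).
  by rewrite (leq_ltn_trans _ (ltn_ord i)) // -ltnS.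
rewrite addrAC subrr add0r; apply: ord_sum => i _; rewrite expr1n mulr1 coefM.
apply: ord_sum => j _; rewrite !coef_poly.
case: ltnP => _; last by rewrite mul0r.
case: ltnP => _; last by rewrite mulr0.
apply: (@ord_le _ _ d (j + (d + i - j))); last exact: ordM.
by rewrite subnKC ?leq_addr // -ltnS.
Qed.

End Sums.

(** * First-order differential operators *)

Section Operators.
Variables (K : numFieldType) (n : nat).
Implicit Types (f g t b : fps K n) (e : 'I_n -> fps K n).

Definition dapp e f : fps K n := \sum_i e i * fps_deriv i f.

Lemma dapp_zmod e : zmod_morphism (dapp e).
Proof.
move=> f g; rewrite /dapp -sumrB; apply: eq_bigr => i _.
by rewrite raddfB mulrBr.
Qed.
HB.instance Definition _ e := GRing.isZmodMorphism.Build (fps K n) (fps K n)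
  (dapp e) (dapp_zmod e).

Lemma dappB e f g : dapp e (f - g) = dapp e f - dapp e g.
Proof. exact: raddfB. Qed.
Lemma dappD e f g : dapp e (f + g) = dapp e f + dapp e g.
Proof. exact: raddfD. Qed.
Lemma dappN e f : dapp e (- f) = - dapp e f.
Proof. exact: raddfN. Qed.
Lemma dapp_sum e I (r : seq I) (P : pred I) (F : I -> fps K n) :
  dapp e (\sum_(i <- r | P i) F i) = \sum_(i <- r | P i) dapp e (F i).
Proof. exact: (raddf_sum (dapp e)). Qed.

Lemma dappM e f g : dapp e (f * g) = dapp e f * g + f * dapp e g.
Proof.
rewrite /dapp mulr_suml mulr_sumr -big_split; apply: eq_bigr => i _ /=.
by rewrite fps_derivM mulrDr mulrA; congr (_ + _); rewrite mulrCA.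
Qed.

Lemma dapp_cst e a : dapp e (fps_cst n a) = 0.
Proof. by rewrite /dapp big1 // => i _; rewrite fps_deriv_cst mulr0. Qed.

Lemma dappX e f k : dapp e (f ^+ k.+1) = k.+1%:R * f ^+ k * dapp e f.
Proof.
rewrite /dapp mulr_sumr; apply: eq_bigr => i _.
by rewrite fps_derivX mulrCA.
Qed.

(** The second-order terms of the two compositions cancel because partial derivatives commute. *)
Lemma dapp_bracket e e' f : dapp e (dapp e' f) - dapp e' (dapp e f) =
  dapp (fun k => dapp e (e' k) - dapp e' (e k)) f.
Proof.
have E c c' : dapp c (dapp c' f) = \sum_k dapp c (c' k) * fps_deriv k f +
    \sum_k \sum_l c' k * c l * fps_deriv l (fps_deriv k f).
  rewrite {2}/dapp dapp_sum -big_split; apply: eq_bigr => k _ /=.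
  rewrite dappM; congr (_ + _); rewrite /dapp mulr_sumr.
  by apply: eq_bigr => l _; rewrite mulrA.
rewrite !E opprD addrACA [X in _ + X](_ : _ = 0) ?addr0.
  by rewrite /dapp -sumrB; apply: eq_bigr => k _; rewrite mulrBl.
apply/eqP; rewrite subr_eq0 exchange_big /=; apply/eqP.
apply: eq_bigr => k _; apply: eq_bigr => l _.
by rewrite fps_derivC [e' l * _]mulrC.
Qed.

Lemma dapp_comp k e (F : fps K k)
    (u : 'I_k -> fps K n) : (forall i, u i 0%MM = 0) ->
  dapp e (fps_comp F u) = \sum_i fps_comp (fps_deriv i F) u * dapp e (u i).
Proof.
move=> u0; rewrite {1}/dapp.
under eq_bigr do rewrite fps_comp_deriv // mulr_sumr.
rewrite exchange_big; apply: eq_bigr => i _ /=.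
by rewrite /dapp mulr_sumr; apply: eq_bigr => j _; rewrite mulrCA.
Qed.

Lemma ord_dapp e d f : ord d.+1 f -> ord d (dapp e f).
Proof. by move=> fd; apply: ord_sum => i _; apply/ordMl/ord_deriv. Qed.

(** In characteristic zero a coefficient at [m] with [m i] nonzero is recovered from the [i]-th
    derivative by dividing by [m i]. *)
Lemma ord_deriv_all d f : f 0%MM = 0 -> (forall i, ord d (fps_deriv i f)) ->
  ord d.+1 f.
Proof.
move=> f0 fd m; have [->|] := eqVneq m 0%MM; first by rewrite f0.
move=> m0 md; have [i mi] : exists i, m i != 0%N.
  apply/existsP; apply: contraR m0; rewrite negb_exists => /forallP m0.
  by apply/eqP/mnmP => i; rewrite mnm0E; apply/eqP; have := m0 i; rewrite negbK.
have E : m = (m - U_(i) + U_(i))%MM.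
  by rewrite submK //; apply/mnm_lepP => j; rewrite mnm1E;
    case: eqP => [<-|] //; rewrite lt0n.
move: md; rewrite E mdegD mdeg1 addn1 ltnS => /(fd i) /= /eqP.
by rewrite mulrn_eq0 /= -E => /eqP.
Qed.

Definition dop e b f := dapp e f + b * f.

Lemma dop0 e f : dop e 0 f = dapp e f.
Proof. by rewrite /dop mul0r addr0. Qed.

Lemma dop_zmod e b : zmod_morphism (dop e b).
Proof. by move=> f g; rewrite /dop raddfB mulrBr opprD addrACA. Qed.
HB.instance Definition _ e b := GRing.isZmodMorphism.Build (fps K n) (fps K n)
  (dop e b) (dop_zmod e b).

Lemma dopM e b f g : dop e b (f * g) = dop e b f * g + f * dapp e g.
Proof. by rewrite /dop dappM mulrDl mulrA addrAC. Qed.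

Lemma ord_dop e b d f : ord d.+1 f -> ord d (dop e b f).
Proof.
by move=> fd; apply: ordD; [apply: ord_dapp|apply/ordMl/(ord_le (leqnSn d))].
Qed.

Lemma ord_iter_dop e b d k f : ord (d + k) f -> ord d (iter k (dop e b) f).
Proof.
elim: k d f => [|k IH] d f; first by rewrite addn0.
by move=> fd; rewrite iterS; apply/ord_dop/IH; rewrite addSnnS.
Qed.

Lemma iter_dop_zmod e b k : zmod_morphism (iter k (dop e b)).
Proof. by move=> f g; elim: k => //= k ->; rewrite raddfB. Qed.
HB.instance Definition _ e b k := GRing.isZmodMorphism.Build (fps K n) (fps K n)
  (iter k (dop e b)) (iter_dop_zmod e b k).

Lemma iter_dop0 e b k : iter k (dop e b) 0 = 0.
Proof. exact: raddf0. Qed.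

Lemma iter_dop_cst e b k a f :
  iter k (dop e b) (fps_cst n a * f) = fps_cst n a * iter k (dop e b) f.
Proof.
elim: k => //= k ->; rewrite mulrC dopM dapp_cst mulr0 addr0; exact: mulrC.
Qed.

(** Leibniz formula with the zeroth-order part [b] carried entirely by the first factor; the
    induction step is Pascal's rule. *)
Lemma iter_dopM e b k f g : iter k (dop e b) (f * g) =
  \sum_(i < k.+1) 'C(k, i)%:R * (iter i (dop e b) f * iter (k - i) (dop e 0) g).
Proof.
elim: k => [|k IH]; first by rewrite big_ord1 bin0 mul1r.
rewrite iterS IH raddf_sum /=.
pose a i := iter i (dop e b) f; pose c i := iter i (dop e 0) g.
transitivity (\sum_(i < k.+1) 'C(k, i)%:R * (a i.+1 * c (k - i)%N) +
    \sum_(i < k.+1) 'C(k, i)%:R * (a i * c (k - i).+1)).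
  rewrite -big_split; apply: eq_bigr => i _ /=; rewrite -mulrDr.
  rewrite -(rmorph_nat (fps_cst n)) [dop e b (fps_cst _ _ * _)](iter_dop_cst e
    b 1) /=; congr (_ * _).
  by rewrite dopM -dop0.
rewrite big_ord_recr [X in _ + X]big_ord_recl [RHS]big_ord_recl [X in _ = _ +
  X]big_ord_recr /=.
rewrite !bin0 !binn subnn subn0 !mul1r addrCA; congr (_ + _).
rewrite addrAC; congr (_ + _); last by rewrite /bump /= add1n subnn.
rewrite -big_split /=; apply: eq_bigr => i _; rewrite /bump /= add1n binS natrD.
by rewrite [LHS]addrC [RHS]mulrDl subSS -[(k - i)%N](subnSK (ltn_ord i)).
Qed.

End Operators.

(** * Retraction along a vector field *)

Section Pi.
Variables (K : numFieldType) (n : nat).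
Implicit Types (f g t b : fps K n) (e : 'I_n -> fps K n).

(* With [P = e + b], this is the exponential [exp (- t P)].  If [e] is a vector
   field with [e t = 1], it maps [f] to the solution of [P u = 0] which agrees
   with [f] on the hypersurface [t = 0]; for [b = 0] it is composition with the
   projection to that hypersurface along the flow lines of [e]. *)
Definition pi_term e b t f k : fps K n :=
  fps_cst n (k`!%:R^-1) * (- t) ^+ k * iter k (dop e b) f.

Definition fps_pi e b t f : fps K n := fsum (pi_term e b t f).

Section Fixed.
Variables (e : 'I_n -> fps K n) (t : fps K n).
Hypothesis t0 : t 0%MM = 0.

Let Nt0 : (- t) 0%MM = 0. Proof. by rewrite fps_coefN t0 oppr0. Qed.

Lemma pi_term_ord b f k : ord k (pi_term e b t f k).
Proof. by apply/ordMr/ordMl/ordX. Qed.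

(** Each use of the operator costs at most one degree, and the factor [(- t) ^+ k] gives [k] degrees
    back. *)
Lemma pi_term_ord_le b f d k : ord d f -> ord d (pi_term e b t f k).
Proof.
move=> fd; apply: (@ord_le _ _ d (k + (d - k))); first by rewrite -leq_subLR.
apply: ordM; first by apply/ordMl/ordX.
have [kd|dk] := leqP k d; first by apply: ord_iter_dop; rewrite subnK.
by rewrite (eqP (ltnW dk)).
Qed.

Lemma fps_pi_approx b f d :
  ord d (fps_pi e b t f - \sum_(k < d) pi_term e b t f k).
Proof. exact/fsum_approx/pi_term_ord. Qed.

Lemma fps_piB b f g : fps_pi e b t (f - g) = fps_pi e b t f - fps_pi e b t g.
Proof.
apply/fpsP => m; rewrite fps_coefB !fsum_coef -sumrB; apply: eq_bigr => k _.
by rewrite /pi_term raddfB mulrBr.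
Qed.

Lemma fps_pi_0 b : fps_pi e b t 0 = 0.
Proof. by have := fps_piB b 0 0; rewrite !subrr. Qed.

Lemma fps_pi_ord b d f : ord d f -> ord d (fps_pi e b t f).
Proof.
by move=> fd m md; rewrite fsum_coef big1 // => k _;
  apply: (pi_term_ord_le b k fd).
Qed.

(** After division by [k!] the Leibniz formula is the Cauchy product of two exponential series. For
    [b = 0] it makes the retraction multiplicative. *)
Lemma fps_piM b f g :
  fps_pi e b t (f * g) = fps_pi e b t f * fps_pi e 0 t g.
Proof.
rewrite [RHS]fsumM; try exact: pi_term_ord.
congr fsum; apply/funext => k; rewrite /pi_term iter_dopM mulr_sumr.
apply: eq_bigr => i _; have ik : (i <= k)%N by rewrite -ltnS.
rewrite -[in (- t) ^+ k](subnKC ik) exprD.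
have -> : fps_cst n (k`!%:R^-1 : K) = fps_cst n (i`!%:R^-1) *
    fps_cst n (((k - i)`!%:R)^-1) * fps_cst n ('C(k, i)%:R^-1).
  by rewrite -!(rmorphM (fps_cst n)) /= -!invfM -!natrM mulnC -(bin_fact ik).
have C0 : 'C(k, i)%:R != 0 :> K by rewrite pnatr_eq0 -lt0n bin_gt0.
rewrite -(rmorph_nat (fps_cst n)).
set c := fps_cst n ('C(k, i)%:R^-1 : K); set c' := fps_cst n ('C(k, i)%:R : K).
have cc : c * c' = 1 by rewrite -(rmorphM (fps_cst n)) /= mulVf ?rmorph1.
set A := fps_cst n _; set B := fps_cst n _; set x := _ ^+ i.
set y := _ ^+ (k - i).
set F := iter i _ f; set G := iter _ _ g.
transitivity (c * c' * (A * x * F * (B * y * G))); last by rewrite cc mul1r.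
by ring.
Qed.

Lemma fps_pi_fix b f : dop e b f = 0 -> fps_pi e b t f = f.
Proof.
move=> f0; apply/fpsP => m; rewrite fsum_coef big_ord_recl big1 ?addr0.
  by rewrite /pi_term fact0 invr1 rmorph1 expr0 !mul1r.
by move=> i _; rewrite /pi_term iterSr f0 iter_dop0 mulr0.
Qed.

Lemma fps_pi_cst a : fps_pi e 0 t (fps_cst n a) = fps_cst n a.
Proof. by rewrite fps_pi_fix // dop0 dapp_cst. Qed.

Lemma fps_pi_comp f :
  fps_pi e 0 t f = fps_comp f (fun i => fps_pi e 0 t (fps_var K i)).
Proof.
apply: fps_comp_uniq.
- by move=> g h; apply: fps_piB.
- by move=> g h; apply: fps_piM.
- exact: fps_pi_cst.
- by move=> d g; apply: fps_pi_ord.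
Qed.

Lemma fps_pi0 f : fps_pi e 0 t f 0%MM = f 0%MM.
Proof.
have -> : f 0%MM = fps_pi e 0 t (fps_cst n (f 0%MM)) 0%MM by rewrite fps_pi_cst
  fps_cst0.
apply/eqP; rewrite -subr_eq0 -fps_coefB -fps_piB (@fps_pi_ord _ 1) ?mdeg0 // =>
  m.
by rewrite ltnS leqn0 mdeg_eq0 => /eqP ->; rewrite fps_coefB fps_cst0 subrr.
Qed.

Lemma fps_pi_unit0 b : fps_pi e b t 1 0%MM = 1.
Proof.
rewrite fsum_coef mdeg0 big_ord1 /pi_term fact0 invr1 rmorph1 expr0 !mul1r /=.
by rewrite eqxx.
Qed.

Section Transversal.
Hypothesis et : dapp e t = 1.

Lemma fps_pi_kill b f : dop e b (fps_pi e b t f) = 0.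
Proof.
apply: ord_eq0 => d; have := ord_dop e b (fps_pi_approx b f (d := d.+1)).
rewrite raddfB raddf_sum /=.
(* As [dapp e t = 1], the operator sends the term of index [k > 0] to [s k - s (k - 1)], and the
   partial sum telescopes to [s d], of order [d]. *)
pose s k := fps_cst n (k`!%:R^-1) * (- t) ^+ k * iter k.+1 (dop e b) f.
have sd : ord d (s d) by apply/ordMr/ordMl/ordX.
suff -> : \sum_(k < d.+1) dop e b (pi_term e b t f k) = s d.
  by move=> /ordD /(_ sd); rewrite subrK.
elim: (d) => [|k IH].
  rewrite big_ord1 /s /pi_term fact0 invr1 rmorph1 expr0 !mul1r //.
rewrite big_ord_recr /= IH /pi_term -mulrA [dop e b _](iter_dop_cst e b 1) /=.
rewrite [(- t) ^+ _ * _]mulrC dopM dappX dappN et.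
have cE : fps_cst n (k`!%:R^-1 : K) = fps_cst n ((k.+1)`!%:R^-1 : K) * k.+1%:R.
  rewrite -(rmorph_nat (fps_cst n)) -(rmorphM (fps_cst n)) /= factS natrM invfM.
  by rewrite mulrC mulrA mulfV ?mul1r ?pnatr_eq0.
rewrite /s cE !iterS exprS; set F := dop e b (iter _ _ _).
by ring.
Qed.

Lemma fps_pi_transversal : fps_pi e 0 t t = 0.
Proof.
apply: ord_eq0 => d; apply: (@ord_le _ _ _ d.+2); first by rewrite leqW.
have := fps_pi_approx 0 t (d := d.+2); rewrite !big_ord_recl big1 => [|i _].
  rewrite addr0 /pi_term /=.
  rewrite dop0 et fact0 (_ :
    1`! = 1)%N // invr1 rmorph1 expr0 expr1 !mul1r mulr1.
  by rewrite subrr subr0.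
have -> : lift ord0 (lift ord0 i) = i.+2 :> nat by rewrite /= /bump !add1n.
by rewrite /pi_term !iterSr !dop0 et -(rmorph1 (fps_cst n)) dapp_cst iter_dop0
  mulr0.
Qed.

Lemma fps_pi_sum b I (r : seq I) (P : pred I) (F : I -> fps K n) :
  fps_pi e b t (\sum_(i <- r | P i) F i) = \sum_(i <- r | P i) fps_pi e b t (F
    i).
Proof.
pose T : {additive fps K n -> fps K n} :=
  HB.pack (fps_pi e b t) (GRing.isZmodMorphism.Build _ _ (fps_pi e b t)
    (fps_piB b)).
exact: (raddf_sum T).
Qed.

(** The outer retraction is multiplicative and kills [t], while all terms of the inner series but
    the first are divisible by [t]: only the restriction to [t = 0] counts. *)
Lemma fps_pi_absorb e' b f : fps_pi e 0 t (fps_pi e' b t f) = fps_pi e 0 t f.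
Proof.
apply: eq_ord => d; apply: (@ord_le _ _ d d.+1) => //.
apply: (@ord_trans _ _ _ _ (fps_pi e 0 t (\sum_(k < d.+1) pi_term e' b t f k))).
  by rewrite -fps_piB; apply/fps_pi_ord/fsum_approx => k;
    apply/ordMr/ordMl/ordX.
rewrite fps_pi_sum big_ord_recl big1 => [|i _].
  by rewrite addr0 /pi_term fact0 invr1 rmorph1 expr0 !mul1r subrr.
have piN : fps_pi e 0 t (- t) = 0.
  by rewrite -[- t]sub0r fps_piB fps_pi_0 fps_pi_transversal subrr.
by rewrite /pi_term !fps_piM exprS fps_piM piN mul0r mulr0 mul0r.
Qed.

End Transversal.
End Fixed.

(** Pullback of dq = sum b_j dw_j along the substitution [fps_pi e 0 t], by the chain rule for [q]
    and for each [w j]. *)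
Lemma fps_pi_gradient e t p q (I : finType) (P : pred I) (b w : I -> fps K n) :
    t 0%MM = 0 ->
    (forall i, fps_deriv i q = \sum_(j | P j) b j * fps_deriv i (w j)) ->
  fps_deriv p (fps_pi e 0 t q) =
  \sum_(j | P j) fps_pi e 0 t (b j) * fps_deriv p (fps_pi e 0 t (w j)).
Proof.
move=> t0 dq.
have chain f : fps_deriv p (fps_pi e 0 t f) =
    \sum_i fps_pi e 0 t (fps_deriv i f) * fps_deriv p (fps_pi e 0 t (fps_var K
      i)).
  rewrite fps_pi_comp // fps_comp_deriv => [|i].
    by apply: eq_bigr => i _; rewrite -fps_pi_comp.
  rewrite fps_pi0 //=; case: eqP => // /mnmP/(_ i).
  by rewrite mnm1E mnm0E eqxx.
rewrite chain (eq_bigr (fun i => \sum_(j | P j) fps_pi e 0 t (b j) *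
    (fps_pi e 0 t (fps_deriv i (w j)) * fps_deriv p (fps_pi e 0 t (fps_var K
      i))))).
  rewrite exchange_big; apply: eq_bigr => j _ /=.
  by rewrite chain mulr_sumr.
move=> i _; rewrite dq fps_pi_sum // mulr_suml; apply: eq_bigr => j _.
by rewrite fps_piM // mulrA.
Qed.

Lemma fps_pi_comm c e t f : t 0%MM = 0 -> dapp c t = 0 ->
    (forall h, dapp c (dapp e h) = dapp e (dapp c h)) ->
  dapp c (fps_pi e 0 t f) = fps_pi e 0 t (dapp c f).
Proof.
move=> t0 ct ce; apply: eq_ord => d.
apply: ord_trans (ord_sym (ord_le (leqnSn d) (fps_pi_approx e t0 0 (dapp c f)
  (d := d.+1)))).
have := ord_dapp c (fps_pi_approx e t0 0 f (d := d.+1)).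
rewrite dappB dapp_sum; set A := \sum_(i < _) _; set B := \sum_(i < _) _.
suff -> : A = B by []; apply: eq_bigr => k _; rewrite /pi_term.
have cX : dapp c ((- t) ^+ k) = 0.
  case: (k : nat) => [|j]; last by rewrite dappX dappN ct oppr0 mulr0.
  by rewrite expr0 -(rmorph1 (fps_cst n)) dapp_cst.
rewrite !dappM dapp_cst cX mul0r mulr0 addr0 mul0r add0r; congr (_ * _).
by elim: (k : nat) => //= j IH; rewrite !dop0 ce IH.
Qed.

(** Terms of index at least 2 contain [t ^+ 2], so only the first two reach the first derivatives at
    the origin. *)
Lemma fps_pi_deriv0 c e t f : t 0%MM = 0 ->
  dapp c (fps_pi e 0 t f) 0%MM = dapp c f 0%MM - dapp c t 0%MM * dapp e f 0%MM.
Proof.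
move=> t0; have := ord_dapp c (fps_pi_approx e t0 0 f (d := 2)).
rewrite !big_ord_recl big_ord0 addr0 /pi_term /= dop0 /bump /= addn0.
rewrite fact0 (_ : 1`! = 1)%N // invr1 rmorph1 expr0 expr1 !mul1r => /(_ 0%MM).
rewrite mdeg0 => /(_ isT)/eqP; rewrite dappB fps_coefB subr_eq0 => /eqP ->.
rewrite dappD fps_coefD /= dappM fps_coefD !fps_coef0M.
by rewrite fps_coefN t0 oppr0 mul0r addr0 dappN fps_coefN mulNr.
Qed.

(** The operator [dapp e - a] kills [g], so its exponential fixes [g]; splitting along [g = 1 * g]
    isolates a factor with constant term 1. *)
Lemma fps_pi_log e t a g : t 0%MM = 0 -> dapp e g = a * g ->
  g = fps_pi e (- a) t 1 * fps_pi e 0 t g.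
Proof.
move=> t0 ga; rewrite -fps_piM // mul1r fps_pi_fix //.
by rewrite /dop ga mulNr subrr.
Qed.

End Pi.

(** * Estimates on polydiscs *)

Section Factorials.

Lemma leq_exp_ffact n m : (n ^ m <= (n + m) ^_ m)%N.
Proof.
elim: m => // m IH; rewrite expnS addnS ffactSS leq_mul //.
by rewrite leqW // leq_addr.
Qed.

Lemma bin_leq_exp n m : ('C(n, m) <= 2 ^ n)%N.
Proof.
elim: n m => [|n IH] [|m] //; first by rewrite bin0 expn_gt0.
by rewrite binS expnS mul2n -addnn leq_add.
Qed.

(** Weak Stirling bound, from (2n)!/n! = C(2n, n) n!. It converts the power [N ^ N] caused by [N]
    equal shrinkings of a polydisc into a factorial. *)
Lemma leq_exp_fact n : (n ^ n <= 4 ^ n * n`!)%N.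
Proof.
apply: leq_trans (leq_exp_ffact n n) _; rewrite -bin_ffact leq_mul2r.
by rewrite (leq_trans (bin_leq_exp _ _)) ?orbT // addnn -mul2n expnM.
Qed.

End Factorials.

Section Bounds.
Variables (K : numFieldType) (n : nat).
Implicit Types (f g : fps K n) (r s M N : K).

(** A bound on the weighted l1 norm at radius [r]; this norm is submultiplicative. *)
Definition bnd f r M := forall d, fps_psum f r d <= M.

Lemma bnd_ge0 f r M : bnd f r M -> 0 <= M.
Proof.
move=> /(_ 0%N); apply: le_trans; rewrite /fps_psum big1 // => -[m] /=.
by rewrite ltn0.
Qed.

Lemma bnd_le f r s M : 0 <= s -> s <= r -> bnd f r M -> bnd f s M.
Proof. by move=> s0 sr fM d; apply: le_trans (fM d); apply: fps_psum_le. Qed.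

Lemma bnd_leM f r M N : M <= N -> bnd f r M -> bnd f r N.
Proof. by move=> MN fM d; apply: le_trans MN. Qed.

Lemma bndN f r M : bnd f r M -> bnd (- f) r M.
Proof.
move=> fM d; apply: le_trans (fM d); apply: ler_sum => m _.
by rewrite fps_coefN normrN.
Qed.

Lemma bndD f g r M N :
  0 <= r -> bnd f r M -> bnd g r N -> bnd (f + g) r (M + N).
Proof.
move=> r0 fM gN d; apply: le_trans (lerD (fM d) (gN d)).
rewrite /fps_psum -big_split; apply: ler_sum => m _ /=.
by rewrite -mulrDl ler_wpM2r ?exprn_ge0 // ler_normD.
Qed.

Lemma bndM f g r M N :
  0 <= r -> bnd f r M -> bnd g r N -> bnd (f * g) r (M * N).
Proof.
move=> r0 fM gN d; apply: le_trans (fps_psumM _ _ _ r0) _.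
by apply: ler_pM; rewrite ?fps_psum_ge0.
Qed.

Lemma bnd_sum (I : Type) (l : seq I) (P : pred I) (F : I -> fps K n) (B :
  I -> K) r :
  0 <= r -> (forall i, P i -> bnd (F i) r (B i)) ->
  bnd (\sum_(i <- l | P i) F i) r (\sum_(i <- l | P i) B i).
Proof.
move=> r0 FB; apply: (big_ind2 (fun f M => bnd f r M)) => //.
  by move=> d; rewrite /fps_psum big1 // => m _; rewrite normr0 mul0r.
by move=> *; apply: bndD.
Qed.

Lemma bnd_cst a r : 0 <= r -> bnd (fps_cst n a) r `|a|.
Proof.
move=> r0 d; rewrite /fps_psum (bigID (fun m : 'X_{1..n < d} =>
  bmnm m == 0%MM)) /=.
rewrite [X in _ + X]big1 ?addr0 => [|m /negbTE m0]; last first.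
  by rewrite m0 normr0 mul0r.
rewrite (eq_bigr (fun=> `|a|)) => [|m /eqP m0]; last first.
  by rewrite m0 eqxx mdeg0 mulr1.
apply: sumr_le1 => // i j /eqP Ei /eqP Ej.
by apply: val_inj; rewrite /= Ei Ej.
Qed.

Lemma bndX f r M k : 0 <= r -> bnd f r M -> bnd (f ^+ k) r (M ^+ k).
Proof.
move=> r0 fM; elim: k => [|k IH]; last by rewrite !exprS; apply: bndM.
by have := bnd_cst (1 : K) r0; rewrite normr1 (rmorph1 (fps_cst n)).
Qed.

Lemma bnd_coef0 f r M : bnd f r M -> `|f 0%MM| <= M.
Proof.
move=> /(_ 1%N); apply: le_trans;
  have m0 : (mdeg (0%MM : 'X_{1..n}) < 1)%N by rewrite mdeg0.
rewrite /fps_psum (bigD1 (BMultinom m0)) //= mdeg0 mulr1 lerDl.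
apply: sumr_ge0 => m m1; suff m0' : bmnm m = 0%MM by rewrite m0' mdeg0 mulr1.
by apply/eqP; rewrite -mdeg_eq0 -leqn0 -ltnS bmdeg.
Qed.

Lemma bernoulli_deriv r s (N : nat) : 0 <= s -> s <= r ->
  N.+1%:R * s ^+ N * (r - s) <= r ^+ N.+1 :> K.
Proof.
move=> s0 sr; have r0 := le_trans s0 sr.
(* Strengthened for the induction: the power function lies above its tangent at [s]. *)
suff: s ^+ N.+1 + N.+1%:R * s ^+ N * (r - s) <= r ^+ N.+1.
  by apply: le_trans; rewrite lerDr exprn_ge0.
elim: N => [|N IH]; first by rewrite !expr1 expr0 !mul1r addrC subrK.
rewrite [leRHS]exprS; apply: le_trans (ler_wpM2l r0 IH).
rewrite -subr_ge0.
have -> : r * (s ^+ N.+1 + N.+1%:R * s ^+ N * (r - s)) -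
   (s ^+ N.+2 + N.+2%:R * s ^+ N.+1 * (r - s)) =
   N.+1%:R * s ^+ N * (r - s) ^+ 2.
  by rewrite -[N.+2%:R]natr1 !exprS expr0; ring.
by rewrite !mulr_ge0 ?exprn_ge0 ?subr_ge0.
Qed.

(** Cauchy estimate: monomial by monomial, [bernoulli_deriv] absorbs the exponent brought down by
    the derivative into the gap between [s] and [r]. *)
Lemma bnd_deriv i f r s M : 0 <= s -> s < r -> bnd f r M ->
  bnd (fps_deriv i f) s (M / (r - s)).
Proof.
move=> s0 sr fM d; have r0 := le_lt_trans s0 sr.
have rs0 : 0 < r - s by rewrite subr_gt0.
pose G (m : 'X_{1..n}) := `|f m| * r ^+ mdeg m.
have G0 m : 0 <= G m by rewrite mulr_ge0 ?exprn_ge0 // ltW.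
rewrite ler_pdivlMr // /fps_psum mulr_suml.
apply: (@le_trans _ _ (\sum_(m : 'X_{1..n < d}) G (m + U_(i))%MM)).
  apply: ler_sum => m _; rewrite /G mdegD mdeg1 addn1 /=.
  rewrite normrMn -mulr_natr -!mulrA ler_wpM2l // !mulrA.
  apply: le_trans (bernoulli_deriv (mdeg m) s0 (ltW sr)).
  rewrite (ler_wpM2r (ltW rs0)) // ler_wpM2r ?exprn_ge0 // ler_nat ltnS.
  by rewrite mdegE (bigD1 i) //= leq_addr.
apply: le_trans (fM d.+1).
have lt_d (m : 'X_{1..n < d}) : (mdeg (m + U_(i))%MM < d.+1)%N.
  by rewrite mdegD mdeg1 addn1 ltnS bmdeg.
rewrite (eq_bigr (fun m : 'X_{1..n < d} => \sum_(k : 'X_{1..n < d.+1} |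
    k == BMultinom (lt_d m)) G k)) => [|m _]; last by rewrite big_pred1_eq.
rewrite (exchange_big_dep xpredT) //=; apply: ler_sum => k _.
apply: sumr_le1 (G0 k) _ => a b /eqP Ea /eqP Eb; apply: val_inj.
by have /(congr1 val)/= := etrans (esym Ea) Eb; apply: addIm.
Qed.

(** Every nonconstant monomial gains at least a factor [s / r] when the radius shrinks from [r] to
    [s]. *)
Lemma bnd_small f r s M : f 0%MM = 0 -> 0 < r -> 0 <= s -> s <= r ->
  bnd f r M -> bnd f s (s / r * M).
Proof.
move=> f0 r0 s0 sr fM d; apply: le_trans (ler_wpM2l _ (fM d)); last first.
  by rewrite divr_ge0 // ltW.
rewrite /fps_psum mulr_sumr; apply: ler_sum => m _.
have [->|m0] := eqVneq (bmnm m) 0%MM; first by rewrite f0 normr0 !mul0r mulr0.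
rewrite mulrCA ler_wpM2l //; move: m0; rewrite -mdeg_eq0.
case: (mdeg m) => // k _; rewrite !exprS mulrA divfK ?gt_eqF //.
by rewrite ler_wpM2l // lerXn2r ?nnegrE // ltW.
Qed.

Lemma bnd_fsum (F : nat -> fps K n) r (B : nat -> K) N : 0 <= r ->
  (forall k, bnd (F k) r (B k)) -> (forall d, \sum_(k < d) B k <= N) ->
  bnd (fsum F) r N.
Proof.
move=> r0 FB BN d; apply: le_trans (BN d).
apply: (@le_trans _ _ (\sum_(k < d) fps_psum (F k) r d)); last first.
  by apply: ler_sum => k _; apply: FB.
rewrite exchange_big /=; apply: ler_sum => m _; rewrite -mulr_suml.
rewrite ler_wpM2r ?exprn_ge0 // fsum_coef.
apply: le_trans (ler_norm_sum _ _ _) _.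
rewrite (big_ord_widen d (fun k => `|F k m|)) ?bmdeg //.
by rewrite [leRHS](bigID (fun k : 'I_d =>
  (k < (mdeg m).+1)%N)) /= lerDl sumr_ge0.
Qed.

Lemma geometric_half M d : 0 <= M -> \sum_(k < d) M * 2^-1 ^+ k <= M * 2.
Proof.
move=> M0; rewrite -mulr_sumr ler_wpM2l //.
suff -> : \sum_(k < d) (2^-1 : K) ^+ k = 2 - 2 * 2^-1 ^+ d.
  by rewrite gerBl mulr_ge0 // exprn_ge0 // invr_ge0.
elim: d => [|d IH]; first by rewrite big_ord0 expr0 mulr1 subrr.
by rewrite big_ord_recr IH exprS /=; field.
Qed.

Lemma conv_bnd f : f \in @convergent K n <-> exists r M, 0 < r /\ bnd f r M.
Proof. by split=> [/asboolP|] //; move=> H; apply/asboolP. Qed.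

Lemma conv_common (I : finType) (F : I -> fps K n) :
  (forall i, F i \in @convergent K n) ->
  exists r M, 0 < r /\ forall i, bnd (F i) r M.
Proof.
move=> Fc; suff [r [M [r0 FM]]] :
  exists r M, 0 < r /\ forall i, i \in enum I -> bnd (F i) r M.
  by exists r, M; split=> // i; apply: FM; rewrite mem_enum.
elim: (enum I) => [|i l [r [M [r0 FM]]]]; first by exists 1, 1.
have /conv_bnd [s [N [s0 iN]]] := Fc i.
have rs0 : 0 < r + s by rewrite addr_gt0.
(* A lower bound of both radii that needs no comparison between them. *)
have t0 : 0 < r * s / (r + s) by rewrite divr_gt0 ?mulr_gt0.
have tr : r * s / (r + s) <= r.
  by rewrite ler_pdivrMr // ler_wpM2l ?ltW // ltrDr.
have ts : r * s / (r + s) <= s.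
  by rewrite ler_pdivrMr // mulrC ler_wpM2l ?ltW // ltrDl.
have N0 := bnd_ge0 iN.
exists (r * s / (r + s)), (`|M| + N); split=> // j;
  rewrite inE => /orP[/eqP->|jl].
  by apply: bnd_leM (bnd_le (ltW t0) ts iN); rewrite lerDr.
have jM := FM j jl; have M0 := bnd_ge0 jM.
by apply: bnd_leM (bnd_le (ltW t0) tr jM); rewrite ger0_norm // lerDl.
Qed.

(* Nagumo's estimate: an operator losing a factor 1/(s - s') when the radius
   shrinks from s to s' is applied N times, at N equally spaced radii. *)
Lemma bnd_word (J : Type) (P : J -> fps K n -> fps K n) r C :
    0 < r -> 0 <= C ->
    (forall j f s s' M, 0 <= s' -> s' < s -> s <= r -> bnd f s M ->
       bnd (P j f) s' (C * M / (s - s'))) ->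
  forall w f M, bnd f r M ->
  bnd (foldr P f w) (r / 2) (M * (8 * C / r) ^+ size w * (size w)`!%:R).
Proof.
move=> r0 C0 HP w f M fM; set N := size w.
have r20 : 0 < r / 2 by rewrite divr_gt0.
have r2r : r / 2 <= r by rewrite ler_pdivrMr // ler_peMr ?ltW // ltr1n.
have M0 := bnd_ge0 fM.
have [N0|N0] := posnP N.
  rewrite N0 expr0 fact0 !mulr1; move/size0nil: N0 => -> /=.
  exact: bnd_le (ltW r20) r2r fM.
have NK0 : 0 < N%:R :> K by rewrite ltr0n.
(* In the final constant 8, a factor 2 comes from this step size and a factor 4 from
   [leq_exp_fact]. *)
pose h := r / 2 / N%:R; have h0 : 0 < h by rewrite divr_gt0.
have step v : (size v <= N)%N ->
    bnd (foldr P f v) (r - (size v)%:R * h) (M * (C / h) ^+ size v).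
  elim: v => [|j v IH] vN /=; first by rewrite mul0r subr0 expr0 mulr1.
  have := HP j _ _ (r - (size v).+1%:R * h) _ _ _ _ (IH (ltnW vN)).
  have -> : r - (size v)%:R * h - (r - (size v).+1%:R * h) = h.
    by rewrite -natr1; ring.
  have -> : C * (M * (C / h) ^+ size v) / h = M * (C / h) ^+ (size v).+1.
    by rewrite exprS; ring.
  apply.
  - rewrite subr_ge0 (le_trans _ r2r) // -[leRHS](divfK (lt0r_neq0 NK0)) -/h.
    by rewrite mulrC (ler_wpM2l (ltW h0)) // ler_nat.
  - by rewrite ltrD2l ltrN2 ltr_pM2r // ltr_nat.
  - by rewrite gerBl mulr_ge0 // ltW.
have := step w (leqnn _); rewrite -/N.
have -> : r - N%:R * h = r / 2.
  by rewrite /h mulrC divfK ?gt_eqF // {1}[r]splitr addrK.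
apply: bnd_leM; rewrite -mulrA ler_wpM2l //.
have -> : C / h = N%:R * (2 * C / r).
  by rewrite /h; field; rewrite !gt_eqF.
have -> : 8 * C / r = 4 * (2 * C / r) by field; rewrite gt_eqF.
have X0 : 0 <= 2 * C / r by rewrite divr_ge0 ?mulr_ge0 // ltW.
move: (2 * C / r) X0 => X X0;
  rewrite !exprMn [leRHS]mulrAC ler_wpM2r ?exprn_ge0 //.
by have := leq_exp_fact N; rewrite -(ler_nat K) natrM !natrX.
Qed.

End Bounds.

(** * Convergence *)

Section Convergence.
Variables (K : numFieldType) (n : nat).
Implicit Types (f g b t : fps K n) (e : 'I_n -> fps K n) (r s M N : K).
Local Notation conv := (@convergent K n).

(** The [n] derivatives cost [A * M / (s - s')] each; the zeroth-order term takes the same form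
    through [s - s' <= r], whence [n%:R + r]. *)
Lemma bnd_dop e b r A s s' f M : 0 < r ->
    (forall i, bnd (e i) r A) -> bnd b r A ->
    0 <= s' -> s' < s -> s <= r -> bnd f s M ->
  bnd (dop e b f) s' (A * (n%:R + r) * M / (s - s')).
Proof.
move=> r0 eA bA s'0 s's sr fM; have A0 := bnd_ge0 bA; have M0 := bnd_ge0 fM.
have ss0 : 0 < s - s' by rewrite subr_gt0.
have s'r : s' <= r by rewrite (le_trans (ltW s's)).
have -> : A * (n%:R + r) * M / (s - s') =
    \sum_(i < n) A * (M / (s - s')) + A * (r * M / (s - s')).
  by rewrite sumr_const card_ord -mulr_natl; ring.
apply: bndD => //.
  apply: bnd_sum => // i _; apply: bndM => //; first exact: bnd_le (eA i).
  exact: bnd_deriv.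
apply: bndM => //; first exact: bnd_le bA.
apply: (@bnd_leM _ _ _ _ M); last exact: bnd_le (ltW s's) fM.
rewrite ler_pdivlMr // mulrC ler_wpM2r // (le_trans _ sr) //.
by rewrite gerBl.
Qed.

Lemma conv_mono f r M : 0 < r -> bnd f r M -> f \in conv.
Proof. by move=> r0 fM; apply/conv_bnd; exists r, M. Qed.

Lemma small_radius r X : 0 < r -> 0 <= X ->
  exists s, [/\ 0 < s, s <= r / 2 & s / r * X <= 2^-1].
Proof.
move=> r0 X0; have X1 : 0 < 1 + X by rewrite (lt_le_trans ltr01) // lerDl.
exists (r / (2 * (1 + X))); split; first by rewrite divr_gt0 ?mulr_gt0.
  rewrite ler_pM2l // lef_pV2 ?posrE ?mulr_gt0 // ler_peMr ?ler0n //.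
  by rewrite lerDl.
have -> : r / (2 * (1 + X)) / r * X = 2^-1 * (X / (1 + X)).
  by field; rewrite !gt_eqF.
by rewrite ler_piMr ?invr_ge0 // ler_pdivrMr // mul1r lerDr.
Qed.

(** The iterated operator grows like a geometric term times [k!], which the exponential series
    divides out; as [t] vanishes at the origin, a small radius makes the remaining ratio at most
    1/2. *)
Lemma fps_pi_conv e b t f : (forall i, e i \in conv) -> b \in conv ->
  t \in conv -> t 0%MM = 0 -> f \in conv -> fps_pi e b t f \in conv.
Proof.
move=> ec bc tc t0 fc.
pose F (i : 'I_n + 'I_3) : fps K n :=
  match i with inl i => e i | inr i => nth b [:: b; t; f] i end.
have [r [M [r0 FM]]] : exists r M, 0 < r /\ forall i, bnd (F i) r M.
  apply: conv_common => -[//|[[|[|[|]]]]] //=.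
have eM i : bnd (e i) r M := FM (inl i).
have bM : bnd b r M := FM (inr (@Ordinal 3 0 isT)).
have tM : bnd t r M := FM (inr (@Ordinal 3 1 isT)).
have fM : bnd f r M := FM (inr (@Ordinal 3 2 isT)).
have M0 := bnd_ge0 bM; pose C := M * (n%:R + r).
have C0 : 0 <= C by rewrite mulr_ge0 // addr_ge0 // ltW.
have X0 : 0 <= M * (8 * C / r) by apply: mulr_ge0 => //; apply: divr_ge0;
  [apply: mulr_ge0|apply: ltW].
have [s [s0 sr2 sX]] := small_radius r0 X0.
have sr : s <= r.
  by rewrite (le_trans sr2) // ler_pdivrMr // ler_peMr ?ltW // ltr1n.
apply: (@conv_mono _ s (M * 2)) => //.
apply: (@bnd_fsum _ _ _ _ (fun k => M * 2^-1 ^+ k)); first exact: ltW.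
  move=> k; have Pk : bnd (iter k (dop e b) f) s (M * (8 * C / r) ^+ k *
    k`!%:R).
    apply: bnd_le (ltW s0) sr2 _.
    have := @bnd_word K n unit (fun _ =>
      dop e b) r C r0 C0 _ (nseq k tt) f M fM.
    rewrite size_nseq (_ : foldr _ _ _ = iter k (dop e b) f); last first.
      by elim: k => //= k ->.
    by apply=> _ g u u' N *; apply: bnd_dop.
  have tk := bndX k (ltW s0) (bndN (bnd_small t0 r0 (ltW s0) sr tM)).
  have := bndM (ltW s0) (bndM (ltW s0) (bnd_cst n (k`!%:R^-1 :
    K) (ltW s0)) tk) Pk.
  apply: bnd_leM; rewrite ger0_norm ?invr_ge0 //.
  have -> : k`!%:R^-1 * (s / r * M) ^+ k * (M * (8 * C / r) ^+ k * k`!%:R) =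
      M * (s / r * (M * (8 * C / r))) ^+ k.
    rewrite [s / r * (M * _)]mulrA [in RHS]exprMn.
    move: ((s / r * M) ^+ k) ((8 * C / r) ^+ k) => x y.
    by field; rewrite pnatr_eq0 -lt0n fact_gt0.
  rewrite ler_wpM2l // lerXn2r ?nnegrE ?invr_ge0 // mulr_ge0 //.
  by rewrite divr_ge0 // ltW.
by move=> d; apply: geometric_half.
Qed.

(** Neumann series in [h = 1 - f / f(0)], which is small on a small polydisc because it vanishes at
    the origin. *)
Lemma conv_inv f : f \in conv -> f 0%MM != 0 ->
  exists2 g, g \in conv & g * f = 1.
Proof.
move=> /conv_bnd [r [M [r0 fM]]] f0; pose c := (f 0%MM)^-1.
pose h := 1 - fps_cst n c * f.
have h0 : h 0%MM = 0.
  by rewrite fps_coefB fps_coef1 eqxx fps_cstM mulVf // subrr.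
pose N := 1 + `|c| * M.
have N0 : 0 <= N by rewrite addr_ge0 // mulr_ge0 // (bnd_ge0 fM).
have hN : bnd h r N.
  apply: bndD; first exact: ltW.
    by have := bnd_cst n (1 : K) (ltW r0); rewrite normr1 rmorph1.
  by apply/bndN/bndM; rewrite ?ltW //; apply/bnd_cst/ltW.
have [s [s0 sr2 sN]] := small_radius r0 N0.
have sr : s <= r.
  by rewrite (le_trans sr2) // ler_pdivrMr // ler_peMr ?ltW // ltr1n.
have hk k : bnd (h ^+ k) s (1 * 2^-1 ^+ k).
  rewrite mul1r; apply: bndX; first exact: ltW.
  exact: bnd_leM sN (bnd_small h0 r0 (ltW s0) sr hN).
have ho k : ord k (h ^+ k) by apply: ordX.
exists (fsum (fun k => h ^+ k) * fps_cst n c).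
  apply: (@conv_mono _ s (1 * 2 * `|c|)) => //;
    apply: bndM (ltW s0) _ (bnd_cst n _ (ltW s0)).
  by apply: bnd_fsum (ltW s0) hk _ => d; apply: geometric_half.
rewrite -mulrA -[fps_cst n c * f](subKr 1) -/h; apply: eq_ord => d.
apply: (@ord_trans _ _ _ _ ((\sum_(k < d) h ^+ k) * (1 - h))).
  by rewrite -mulrBl; apply/ordMr/fsum_approx.
by rewrite mulrC -[1 - h]opprB mulNr -subrX1 opprB addrAC subrr add0r;
  apply: ordN.
Qed.

(** Bound on multinomial coefficients; the induction lowers a largest entry of [b], which is at
    least the average. *)
Lemma fact_multinom k (b : 'X_{1..k}) :
  ((mdeg b)`! <= k ^ mdeg b * \prod_(i < k) (b i)`!)%N.
Proof.
move: {2}(mdeg b) (erefl (mdeg b)) => N; elim: N b => [|N IH] b bN.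
  by rewrite bN fact0 mul1n prodn_gt0 // => i; rewrite fact_gt0.
have [i bi] : exists i, (mdeg b <= k * b i)%N.
  case: k b IH bN => [|k] b IH bN.
    by move: bN; rewrite mdegE big_ord0.
  exists [arg max_(i > ord0) b i]; case: arg_maxnP => // i _ ib.
  apply: (@leq_trans (\sum_(j < k.+1) b i));
    last by rewrite sum_nat_const card_ord.
  by rewrite mdegE; apply: leq_sum => j _; apply: ib.
have bi0 : (0 < b i)%N by move: bi; rewrite bN; case: (b i) => //;
  rewrite muln0.
pose c := (b - U_(i))%MM.
have bc : b = (c + U_(i))%MM.
  by rewrite submK //; apply/mnm_lepP => j; rewrite mnm1E; case: eqP => [<-|].
have cN : mdeg c = N by apply: succn_inj; rewrite -bN bc mdegD mdeg1 addn1.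
have := IH c cN; rewrite bN cN => cle.
have -> : (\prod_(j < k) (b j)`! = b i * \prod_(j < k) (c j)`!)%N.
  rewrite (bigD1 i) //= [in RHS](bigD1 i) //= mulnA /c; congr muln.
    by rewrite mnmBE mnm1E eqxx subn1 -[in LHS](prednK bi0) factS prednK.
  by apply: eq_bigr => j ji; rewrite mnmBE mnm1E eq_sym (negbTE ji) subn0.
by rewrite factS expnS mulnACA leq_mul // -bN.
Qed.

End Convergence.

Lemma conv_geometric (K : numFieldType) k (F : fps K k) (M R : K) : 0 <= R ->
  (forall b, `|F b| <= M * R ^+ mdeg b) -> F \in @convergent K k.
Proof.
move=> R0 FM; have R1 : 0 < 1 + R by rewrite (lt_le_trans ltr01) // lerDl.
have M0 : 0 <= M.
  by have := FM 0%MM; rewrite mdeg0 expr0 mulr1; apply: le_trans.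
(* This radius makes [R * r] at most 1/2. *)
pose q : K := 2^-1; pose r := q / (1 + R).
have q0 : 0 < q by rewrite invr_gt0.
have r0 : 0 < r by rewrite divr_gt0.
have q0' := ltW q0; have r0' := ltW r0.
apply: (@conv_mono _ _ _ r (M * 2 ^+ k)) => // d.
apply: (@le_trans _ _ (\sum_(b : 'X_{1..k < d}) M * q ^+ mdeg b)).
  apply: ler_sum => b _; apply: le_trans (ler_wpM2r _ (FM b)) _.
    by rewrite exprn_ge0 // ltW.
  rewrite -mulrA ler_wpM2l // -exprMn lerXn2r ?nnegrE ?(mulr_ge0 R0 r0') //.
  by rewrite /r mulrA ler_pdivrMr // mulrC (ler_wpM2l (ltW q0)) // lerDr.
rewrite -mulr_sumr ler_wpM2l //.
(* The multi-indices of degree below [d] lie in a box, over which the sum factors into one-variable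
   geometric sums. *)
apply: (@le_trans _ _ (\prod_(i < k) \sum_(j < d) q ^+ j)); last first.
  rewrite -[k in leRHS]card_ord -prodr_const; apply: ler_prod => i _.
  rewrite sumr_ge0 => [|j _]; last by rewrite exprn_ge0 // ltW.
  have := geometric_half d (@ler01 K); rewrite mul1r; apply: le_trans.
  by apply: ler_sum => j _; rewrite mul1r.
rewrite bigA_distr_bigA /=.
have lt_d (b : 'X_{1..k < d}) i : (b i < d)%N.
  by apply: leq_ltn_trans (bmdeg b); rewrite mdegE (bigD1 i) //= leq_addr.
pose h (b : 'X_{1..k < d}) : {ffun 'I_k -> 'I_d} := [ffun i =>
  Ordinal (lt_d b i)].
pose H (f : {ffun 'I_k -> 'I_d}) := \prod_i q ^+ f i.
rewrite (eq_bigr (fun b : 'X_{1..k < d} => \sum_(f | f == h b) H f)) => [|b _].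
  rewrite (exchange_big_dep xpredT) //=; apply: ler_sum => f _.
  apply: sumr_le1; first by rewrite prodr_ge0 // => i _;
    rewrite exprn_ge0 // ltW.
  move=> a b /eqP -> /eqP /ffunP ab; apply/val_inj/mnmP => i.
  by have /(congr1 val) := ab i; rewrite !ffunE.
rewrite big_pred1_eq /H mdegE -prodrXr; apply: eq_bigr => i _.
by rewrite ffunE.
Qed.

(** * Frames and Taylor expansion *)

Section Frame.
Variables (K : numFieldType) (n : nat).
Local Notation conv := (@convergent K n).
Variables (y : 'I_n -> fps K n) (B : 'I_n -> 'I_n -> fps K n).
Hypothesis y0 : forall i, y i 0%MM = 0.
Hypothesis By : forall i l, dapp (B i) (y l) = (i == l)%:R.
Hypothesis yB : forall i k, \sum_l fps_deriv i (y l) * B l k = (i == k)%:R.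
Implicit Types (f g : fps K n) (e : 'I_n -> fps K n).

(** The field [B l] is the partial derivative in the coordinate [y l]; [yB] gives the change of
    frame. *)
Lemma frame_deriv i f : fps_deriv i f = \sum_l fps_deriv i (y l) * dapp (B l) f.
Proof.
under eq_bigr do rewrite mulr_sumr.
rewrite exchange_big /= (bigD1 i) //= [X in _ + X]big1 => [|k ki].
  under eq_bigr do rewrite mulrA.
  by rewrite -mulr_suml yB eqxx mul1r addr0.
under eq_bigr do rewrite mulrA.
by rewrite -mulr_suml yB eq_sym (negbTE ki) mul0r.
Qed.

Lemma frame_dapp e f : dapp e f = \sum_l dapp e (y l) * dapp (B l) f.
Proof.
rewrite {1}/dapp; under eq_bigr do rewrite frame_deriv mulr_sumr.
rewrite exchange_big; apply: eq_bigr => l _ /=.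
by rewrite {2}/dapp mulr_suml; apply: eq_bigr => i _; rewrite mulrA.
Qed.

(** The bracket of two frame fields kills every [y l], since each [dapp (B i) (y l)] is constant; by
    [frame_dapp] it is zero. *)
Lemma frame_comm i j f :
  dapp (B i) (dapp (B j) f) = dapp (B j) (dapp (B i) f).
Proof.
have Dnat e (b : bool) : dapp e b%:R = 0.
  by rewrite -(rmorph_nat (fps_cst n)) dapp_cst.
apply/eqP; rewrite -subr_eq0 dapp_bracket frame_dapp big1 // => l _.
by rewrite -dapp_bracket !By !Dnat subrr mul0r.
Qed.

(* [iota] selects the coordinates on which the expanded series depends. *)
Section Taylor.
Variables (k : nat) (iota : 'I_k -> 'I_n).
Hypothesis iota_inj : injective iota.

(** A multi-index as a word, so that the iterated derivative is a [foldr] to which [bnd_word]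
    applies. *)
Definition mword (b : 'X_{1..k}) : seq 'I_k :=
  flatten [seq nseq (b i) i | i <- enum 'I_k].

Lemma count_mword a b : count a (mword b) = (\sum_i a i * b i)%N.
Proof.
rewrite /mword count_flatten -map_comp sumnE big_map big_enum /=.
by apply: eq_bigr => i _; rewrite /= count_nseq.
Qed.

Lemma size_mword b : size (mword b) = mdeg b.
Proof.
rewrite -count_predT count_mword mdegE.
by apply: eq_bigr => i _; rewrite mul1n.
Qed.

Let D (i : 'I_k) := dapp (B (iota i)).

Lemma frame_word_cons i w f : foldr D (D i f) w = foldr D f (i :: w).
Proof. by elim: w => //= j w ->; rewrite /= /D frame_comm. Qed.

Lemma frame_word_perm w w' f : perm_eq w w' -> foldr D f w = foldr D f w'.
Proof.
elim: w w' f => [|i w IH] w' f ww'.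
  by rewrite perm_sym in ww'; rewrite (perm_nilP ww').
have iw' : i \in w' by rewrite -(perm_mem ww') mem_head.
case/splitPr: iw' ww' => w1 w2;
  rewrite perm_sym -[i :: w2]cat1s perm_catCA cat1s perm_cons => ww'.
rewrite -frame_word_cons (IH (w1 ++ w2)) 1?perm_sym //.
by rewrite !foldr_cat frame_word_cons.
Qed.

Definition taylor f : fps K k := FPS (fun b : 'X_{1..k} =>
  foldr D f (mword b) 0%MM / (\prod_i (b i)`!)%:R).

Lemma taylor_deriv i f : taylor (D i f) = fps_deriv i (taylor f).
Proof.
apply/fpsP => b /=; rewrite frame_word_cons.
rewrite (@frame_word_perm _ (mword (b + U_(i))%MM)); last first.
  apply/permP => a; rewrite /= !count_mword.
  under [RHS]eq_bigr do rewrite mnmDE mulnDr.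
  rewrite big_split /= addnC; congr (_ + _)%N.
  rewrite (bigD1 i) //= mnm1E eqxx muln1 big1 ?addn0 // => j ji.
  by rewrite mnm1E eq_sym (negbTE ji) muln0.
rewrite -[RHS]mulrnAr; congr (_ * _).
rewrite [in RHS](bigD1 i) //= [in LHS](bigD1 i) //= mnmDE mnm1E eqxx addn1.
rewrite factS [in RHS](eq_bigr (fun j => (b j)`!)) => [|j ji]; last first.
  by rewrite mnmDE mnm1E eq_sym (negbTE ji) addn0.
rewrite -mulnA [in RHS]natrM invfM -[RHS]mulr_natr [RHS]mulrC.
by rewrite mulrA mulfV ?mul1r // pnatr_eq0.
Qed.

(** The difference [E f] vanishes at the origin and its frame derivatives are zero or of the form
    [E (D i f)]; the induction on the order of vanishing runs over all [f] at once. *)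
Lemma taylorE f : (forall j, j \notin codom iota -> dapp (B j) f = 0) ->
  fps_comp (taylor f) (y \o iota) = f.
Proof.
move=> fB; apply/esym/eq_ord; pose E f := f - fps_comp (taylor f) (y \o iota).
have yi0 i : (y \o iota) i 0%MM = 0 by apply: y0.
have EB i g : dapp (B (iota i)) (E g) = E (D i g).
  rewrite /E dappB dapp_comp // taylor_deriv; congr (_ - _).
  rewrite (bigD1 i) //= By eqxx mulr1 big1 ?addr0 // => j ji.
  by rewrite By (inj_eq iota_inj) eq_sym (negbTE ji) mulr0.
have EB0 j g : j \notin codom iota -> dapp (B j) g = 0 -> dapp (B j) (E g) = 0.
  move=> ji gj; rewrite /E dappB gj dapp_comp // big1 ?subr0 // => i _ /=.
  rewrite By; case: eqP => [jE|]; last by rewrite mulr0.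
  by rewrite jE codom_f in ji.
move=> d; rewrite -/(E f); elim: d f fB => [|d IH] f fB; first by [].
apply: ord_deriv_all => [|i].
  rewrite fps_coefB fps_comp0 //= /mword.
  rewrite (_ : flatten _ = [::]) /=; last first.
    by apply/size0nil; rewrite -/(mword 0%MM) size_mword mdeg0.
  by rewrite big1 ?divr1 ?subrr // => i _; rewrite mnm0E.
rewrite frame_deriv; apply: ord_sum => l _; apply: ordMl.
case: (boolP (l \in codom iota)) => [/codomP[j ->]|lj]; last first.
  by rewrite EB0 // fB.
by rewrite EB; apply: IH => l' l'j;
  rewrite /D frame_comm fB // [dapp _ 0]raddf0.
Qed.

(** [bnd_word] bounds the derivatives by a geometric term times the factorial of [mdeg b]; divided
    by the factorials of the [b i], this is geometric by [fact_multinom]. *)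
Lemma taylor_conv f : (forall i j, B i j \in conv) -> f \in conv ->
  taylor f \in @convergent K k.
Proof.
move=> Bc fc.
pose F (i : ('I_n * 'I_n) + unit) : fps K n :=
  match i with inl i => B i.1 i.2 | inr _ => f end.
have [r [M [r0 FM]]] : exists r M, 0 < r /\ forall i, bnd (F i) r M.
  by apply: conv_common => -[[i j]|[]] //=.
have BM i j : bnd (B i j) r M := FM (inl (i, j)).
have fM : bnd f r M := FM (inr tt).
have M0 := bnd_ge0 fM; pose C := M * (n%:R + r).
have C0 : 0 <= C by rewrite mulr_ge0 // addr_ge0 // ltW.
have R0 : 0 <= 8 * C / r by apply: divr_ge0; [apply: mulr_ge0|apply: ltW].
have Z0 : bnd (0 : fps K n) r M.
  by move=> d; rewrite /fps_psum big1 // => m _; rewrite normr0 mul0r.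
have HD (j : 'I_k) g s s' N : 0 <= s' -> s' < s -> s <= r -> bnd g s N ->
    bnd (D j g) s' (C * N / (s - s')).
  by move=> *; rewrite /D -dop0; apply: bnd_dop.
apply: (@conv_geometric _ _ _ M (8 * C / r * k%:R)).
  by rewrite mulr_ge0 // ler0n.
move=> b /=; have := bnd_coef0 (bnd_word r0 C0 HD (mword b) fM).
rewrite size_mword => le1; rewrite normrM normfV normr_nat ler_pdivrMr;
  last first.
  by rewrite ltr0n prodn_gt0 // => i; rewrite fact_gt0.
move: (8 * C / r) R0 le1 => R R0 le1.
apply: le_trans le1 _;
  rewrite exprMn -!mulrA ler_wpM2l // ler_wpM2l ?exprn_ge0 //.
by have := fact_multinom b; rewrite -(ler_nat K) natrM natrX.
Qed.

End Taylor.

Lemma frame_comp_inj (F : fps K n) : fps_comp F y = 0 -> F = 0.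
Proof.
move=> Fy; apply: ord_eq0 => d; elim: d F Fy => // d IH F Fy.
apply: ord_deriv_all => [|i]; first by rewrite -(fps_comp0 y0) Fy.
apply: IH; have : dapp (B i) (fps_comp F y) = 0 by rewrite Fy; apply: raddf0.
rewrite dapp_comp // (bigD1 i) //= By eqxx mulr1 big1 ?addr0 // => j ji.
by rewrite By eq_sym (negbTE ji) mulr0.
Qed.

End Frame.

(** * Straightening logarithmic vector fields *)

Section Straightening.
Variables (K : numFieldType) (n : nat).
Local Notation conv := (@convergent K n).
Variables (xi : 'I_n -> fps K n) (A : 'I_n -> 'I_n -> fps K n).
Hypothesis xi0 : forall i, xi i 0%MM = 0.
Hypothesis xic : forall i, xi i \in conv.
Hypothesis Ac : forall i j, A i j \in conv.
Hypothesis Axi : forall i l, dapp (A i) (xi l) = (i == l)%:R.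
Hypothesis xiA : forall i k, \sum_l fps_deriv i (xi l) * A l k = (i == k)%:R.
Implicit Types (f g : fps K n) (c : 'I_n -> 'I_n -> fps K n) (S T : seq 'I_n).

Lemma fps_coef_nat (b : bool) : (b%:R : fps K n) 0%MM = b%:R.
Proof. by case: b; rewrite ?fps_coef1 ?eqxx. Qed.

(* [S] indexes the coordinates already eliminated from [g]: the step for [j]
   replaces [g] and the remaining fields by their restrictions to [xi j = 0],
   and recovers [g], up to a unit, as the extension of its restriction that is
   constant along the [j]-th field. *)
Lemma straighten T : forall S g c, uniq T -> g \in conv ->
    (forall i k, c i k \in conv) ->
    (forall s, s \in S -> dapp (A s) g = 0) ->
    (forall i k, i \in T -> c i k 0%MM = (i == k)%:R) ->
    (forall i, i \in T -> exists2 a, a \in conv &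
       \sum_k c i k * dapp (A k) g = a * g) ->
  exists u q (w b : 'I_n -> fps K n),
    [/\ [/\ u \in conv, q \in conv, u 0%MM = 1 & g = u * q],
        forall i, w i \in conv,
        forall i, i \notin T ++ S -> w i 0%MM = 0 /\
          forall k, dapp (A k) (w i) 0%MM = (k == i)%:R &
        forall p, fps_deriv p q =
          \sum_(i | i \notin T ++ S) b i * fps_deriv p (w i)].
Proof.
elim: T => [|j T IH] S g c uT gc cc gS c0 cg.
  exists 1, g, xi, (fun i => dapp (A i) g); split=> [||i _|p].
  - by rewrite fps_coef1 eqxx mul1r; split=> //; apply: rpred1.
  - exact: xic.
  - by split=> // k; rewrite Axi fps_coef_nat.
  - rewrite (frame_deriv xiA) (bigID (fun i => i \in S)) /= big1 ?add0r.
      by apply: eq_bigr => i _; rewrite mulrC.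
    by move=> i iS; rewrite gS // mulr0.
have jT : j \notin T by case/andP: uT.
have {}uT : uniq T by case/andP: uT.
have cj0 : c j j 0%MM = 1 by rewrite c0 ?mem_head // eqxx.
have [e ec ecj] : exists2 e, e \in conv & e * c j j = 1.
  by apply: conv_inv => //; rewrite cj0 oner_neq0.
have e0 : e 0%MM = 1.
  by have := fps_coef0M e (c j j); rewrite ecj cj0 mulr1 fps_coef1 eqxx => <-.
have [aj ajc gj] := cg j (mem_head _ _).
(* The [j]-th field, normalised to send [xi j] to 1; it stays logarithmic for [g]. *)
pose d k := \sum_l e * c j l * A l k.
have dE f : dapp d f = \sum_l e * c j l * dapp (A l) f.
  rewrite {1}/dapp; under eq_bigr do rewrite mulr_suml.
  rewrite exchange_big; apply: eq_bigr => l _ /=.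
  by rewrite /dapp mulr_sumr; apply: eq_bigr => k _; rewrite mulrA.
have dxi : dapp d (xi j) = 1.
  rewrite dE (bigD1 j) //= Axi eqxx mulr1 ecj big1 ?addr0 // => l lj.
  by rewrite Axi (negbTE lj) mulr0.
have dg : dapp d g = e * aj * g.
  by rewrite dE -mulrA -gj mulr_sumr; apply: eq_bigr => l _; rewrite mulrA.
have dc k : d k \in conv by apply: rpred_sum => l _; rewrite !rpredM.
have Axij : dapp (A j) (xi j) = 1 by rewrite Axi eqxx.
(* [rho] restricts to [xi j = 0], [Pi] extends back along [d]. *)
pose rho := fps_pi (A j) 0 (xi j); pose Pi := fps_pi d 0 (xi j).
have rhoc f : f \in conv -> rho f \in conv.
  by move=> fc; apply: fps_pi_conv => //; apply: rpred0.
have Pic f : f \in conv -> Pi f \in conv.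
  by move=> fc; apply: fps_pi_conv => //; apply: rpred0.
have rhoA s f : s != j -> dapp (A s) (rho f) = rho (dapp (A s) f).
  move=> sj; apply: fps_pi_comm => //; first by rewrite Axi (negbTE sj).
  by move=> h; apply: (frame_comm Axi xiA).
have rhoj f : dapp (A j) (rho f) = 0 by rewrite -dop0 fps_pi_kill.
have rhoM f h : rho (f * h) = rho f * rho h by apply: fps_piM.
have rho_sum (F : 'I_n -> fps K n) : rho (\sum_k F k) = \sum_k rho (F k).
  exact: fps_pi_sum.
(* Subtracting a multiple of the [j]-th field removes the component along [A j], so that the
   restricted field is logarithmic for [rho g]. *)
pose c' i k := rho (c i k - c i j * (e * c j k)).
have {IH} [||||| u' [q [w [b [[u'c qc u'0 gq] wc w0 qw]]]]] :=
    IH (j :: S) (rho g) c' uT; first exact: rhoc.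
- by move=> i k; apply: rhoc; rewrite rpredB ?rpredM.
- move=> s; rewrite inE; have [->|sj] /= := eqVneq s j; first by rewrite rhoj.
  by move=> sS; rewrite rhoA // gS // /rho fps_pi_0.
- move=> i k iT; rewrite /c' /rho fps_pi0 // fps_coefB fps_coef0M.
  rewrite !c0 ?inE ?iT ?orbT // (_ : i == j = false) ?mul0r ?subr0 //.
  by apply: contraNF jT => /eqP <-.
- move=> i iT; have [a ac gi] : exists2 a, a \in conv &
      \sum_k c i k * dapp (A k) g = a * g by apply: cg; rewrite inE iT orbT.
  exists (rho (a - c i j * (e * aj))); first by apply: rhoc;
    rewrite rpredB ?rpredM.
  rewrite -rhoM mulrBl -gi -!mulrA -gj !mulr_sumr -sumrB rho_sum.
  apply: eq_bigr => k _; rewrite !mulrA -mulrBl rhoM -!mulrA.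
  have [->|kj] := eqVneq k j; last by rewrite rhoA.
  by rewrite /c' ecj mulr1 subrr /rho fps_pi_0 !mul0r.
have notinE i : (i \notin (j :: T) ++ S) = (i \notin T ++ (j :: S)).
  by rewrite !(mem_cat, inE); case: (i == j); case: (i \in T).
(* The unit combines the factor split off by [fps_pi_log] with the extension of the unit found for
   [rho g]. *)
exists (fps_pi d (- (e * aj)) (xi j) 1 * Pi u'), (Pi q), (Pi \o w), (Pi \o b).
split=> [||i|p].
- split.
  + apply: rpredM; last exact: Pic.
    by apply: fps_pi_conv; rewrite ?rpredN ?rpredM ?rpred1.
  + exact: Pic.
  + by rewrite fps_coef0M fps_pi_unit0 fps_pi0 // u'0 mulr1.
  + rewrite {1}(fps_pi_log (xi0 j) dg) -mulrA; congr (_ * _).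
    by rewrite -(fps_pi_absorb (xi0 j) dxi (A j) 0) -/(rho g) gq fps_piM.
- by move=> i; apply: Pic.
- rewrite notinE => iTS; have [wi0 wi] := w0 i iTS; split=> [|k].
    by rewrite [LHS](fps_pi0 d (xi0 j)).
  (* Extending [w i] could change its differential at the origin only along [xi j], by the value of
     [dapp d (w i)] there, which is that of [c j i]: zero as [i != j]. *)
  rewrite [LHS](fps_pi_deriv0 (A k) d (w i) (xi0 j)) Axi fps_coef_nat wi.
  rewrite dE fps_coef_sum (bigD1 i) // fps_coef0M wi eqxx mulr1.
  rewrite big1 ?addr0 => [|l li]; last first.
    by rewrite fps_coef0M wi (negbTE li) mulr0.
  rewrite fps_coef0M e0 c0 ?mem_head // mul1r.
  have /negbTE -> : j != i by move: iTS;
    rewrite mem_cat inE !negb_or eq_sym => /and3P[].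
  by rewrite [X in _ * X]addr0 mulr0 subr0.
- rewrite (fps_pi_gradient d p (xi0 j) qw).
  by apply: eq_bigl => i; rewrite notinE.
Qed.

End Straightening.

(** * Germs of vector fields *)

(** The row spaces of [D1] and [D2] span everything: [A] stacks a basis of that of [D2], of size
    [k], and a basis of a complement taken inside that of [D1]. *)
Lemma complementary_rows (F : fieldType) n (D1 D2 : 'M[F]_n) : D1 + D2 = 1%:M ->
  exists k l (kl : (k + l)%N = n) (A C : 'M[F]_n), A \in unitmx /\
    forall i : 'I_n, row i A = row i (C *m (if (i < k)%N then D2 else D1)).
Proof.
move=> D12; pose E := (D1 :\: D2)%MS.
have E0 : (D2 :&: E = 0)%MS.
  by apply/eqP; rewrite capmxC capmx_diff.
have rk : (\rank D2 + \rank E)%N = n.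
  rewrite -mxrank_disjoint_sum //; apply/eqP; rewrite -[_ == _]/(row_full _).
  rewrite -sub1mx -D12 addmx_sub ?addsmxSl //.
  rewrite -(addsmx_diff_cap_eq D1 D2) addsmx_sub addsmxSr.
  exact: submx_trans (capmxSr _ _) (addsmxSl _ _).
pose A0 := col_mx (row_base D2) (row_base E).
have rA0 : row_free A0.
  rewrite /row_free -addsmxE (adds_eqmx (eq_row_base _) (eq_row_base _)).
  by rewrite mxrank_disjoint_sum.
pose A := castmx (rk, erefl n) A0.
have rowA (i : 'I_n) : (row i A <= if (i < \rank D2)%N then D2 else D1)%MS.
  have -> : row i A = row (cast_ord (esym rk) i) A0.
    by apply/rowP => j; rewrite !mxE castmxE cast_ord_id mxE.
  case: (split_ordP (cast_ord (esym rk) i)) => j ->.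
    by rewrite rowKu (submx_trans (row_sub _ _)) ?eq_row_base.
  rewrite rowKd (submx_trans (row_sub _ _)) // eq_row_base.
  exact: diffmxSl.
have H (i : 'I_n) : exists c, row i A = c *m (if (i < \rank D2)%N then D2 else
  D1).
  by have /submxP[c ->] := rowA i; exists c.
have [c cE] := fin_all_exists H.
do 2!eexists; exists rk, A, (\matrix_i c i); split.
  by rewrite -row_free_unit row_free_castmx.
by move=> i; rewrite row_mul rowK.
Qed.

Section Cps.
Variables (K : numFieldType) (n : nat).
Local Notation conv := (@convergent K n).
Local Notation O := (cps K n).
Implicit Types (f g : O).

Lemma cps_valM f g : cps_val (f * g) = cps_val f * cps_val g. Proof. by []. Qed.
Lemma cps_val_sum I (r : seq I) (P : pred I) (F : I -> O) :
  cps_val (\sum_(i <- r | P i) F i) = \sum_(i <- r | P i) cps_val (F i).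
Proof. by elim/big_ind2: _ => // x a z b <- <-. Qed.
Lemma cps_val_nat (b : bool) : cps_val (b%:R : O) = b%:R.
Proof. by case: b. Qed.
Lemma cps_val_inj : injective (@cps_val K n).
Proof. exact: val_inj. Qed.

Lemma cps_derE (d : 'rV[O]_n) f :
  cps_val (apply_der d f) = dapp (fun i => cps_val (d 0 i)) (cps_val f).
Proof. by rewrite cps_val_sum. Qed.

Definition cst_term f : K := f 0%MM.

Lemma cst_term_zmod : zmod_morphism cst_term. Proof. by []. Qed.
Lemma cst_term_monoid : monoid_morphism cst_term.
Proof.
split; first by rewrite /cst_term fps_coef1 eqxx.
by move=> f g; rewrite /cst_term fps_coef0M.
Qed.
HB.instance Definition _ := GRing.isZmodMorphism.Build O K cst_term
  cst_term_zmod.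
HB.instance Definition _ := GRing.isMonoidMorphism.Build O K cst_term
  cst_term_monoid.

Lemma cps_unitE f : (f \is a GRing.unit) = (f 0%MM != 0).
Proof.
apply/idP/idP => [fU|f0].
  apply: contraTneq (oner_neq0 K) => f0; rewrite negbK.
  by rewrite -(rmorph1 cst_term) -(mulVr fU) rmorphM /= [cst_term f]f0 mulr0
    eqxx.
have [g gc gf] := conv_inv (cps_valP f) f0.
have E : CPS gc * f = 1 by apply: cps_val_inj.
by apply/unitrP; exists (CPS gc); split=> //; rewrite mulrC.
Qed.

(** The Jacobian matrix is invertible over the local ring once its value at the origin is; the rows
    of the inverse form the dual frame. *)
Lemma frame_exists (y : 'I_n -> O) :
    \matrix_(i, l) (partial i (y l) : fps K n) 0%MM \in unitmx ->
  exists B : 'M[O]_n,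
    (forall i l, dapp (fun j =>
      cps_val (B i j)) (cps_val (y l)) = (i == l)%:R) /\
    (forall i k, \sum_l fps_deriv i (cps_val (y l)) * cps_val (B l k) = (i ==
      k)%:R).
Proof.
move=> J0; pose J : 'M[O]_n := \matrix_(i, l) partial i (y l).
have JU : J \in unitmx.
  rewrite unitmxE cps_unitE -[_ 0%MM]/(cst_term _) -det_map_mx -unitfE -unitmxE.
  by rewrite (_ : map_mx _ _ = \matrix_(i, l) (partial i (y l) :
    fps K n) 0%MM) //; apply/matrixP => i l; rewrite !mxE.
exists (invmx J); split=> [i l|i k].
  have /matrixP/(_ i l) := mulVmx JU; rewrite !mxE => /(congr1 (@cps_val K n)).
  rewrite cps_val_nat => <-; rewrite cps_val_sum; apply: eq_bigr => j _.
  by rewrite mxE cps_valM.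
have /matrixP/(_ i k) := mulmxV JU; rewrite !mxE => /(congr1 (@cps_val K n)).
rewrite cps_val_nat => <-; rewrite cps_val_sum; apply: eq_bigr => j _.
by rewrite mxE cps_valM.
Qed.

Lemma apply_derM (d : 'rV[O]_n) f g :
  apply_der d (f * g) = apply_der d f * g + f * apply_der d g.
Proof. by apply: cps_val_inj; rewrite cps_derE dappM -!cps_derE. Qed.

Lemma apply_derDl (d e : 'rV[O]_n) f :
  apply_der (d + e) f = apply_der d f + apply_der e f.
Proof.
rewrite /apply_der -big_split; apply: eq_bigr => i _.
by rewrite mxE mulrDl.
Qed.

Lemma apply_derZl a (d : 'rV[O]_n) f : apply_der (a *: d) f = a * apply_der d f.
Proof.
by rewrite /apply_der mulr_sumr; apply: eq_bigr => i _; rewrite mxE mulrA.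
Qed.

Lemma apply_der_suml (I : finType) (P : pred I) (d : I -> 'rV[O]_n) f :
  apply_der (\sum_(i | P i) d i) f = \sum_(i | P i) apply_der (d i) f.
Proof.
rewrite /apply_der exchange_big; apply: eq_bigr => i _.
by rewrite summxE mulr_suml.
Qed.

(** Each generator is a multiple of the other, and the derivative of [a * f] is [apply_der d a * f]
    when [d] kills [f]. *)
Lemma der_log_ideal d f g :
  ideal f = ideal g -> apply_der d f = 0 -> der_log g d.
Proof.
move=> fg df.
have [a ga] : divides f g.
  by rewrite -[divides f g]/(ideal f g) fg; exists 1; rewrite mul1r.
have [b fb] : divides g f.
  by rewrite -[divides g f]/(ideal g f) -fg; exists 1; rewrite mul1r.
exists (apply_der d a * b); rewrite {1}ga apply_derM df mulr0 addr0 -mulrA.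
by rewrite -fb.
Qed.

End Cps.

(** * The equivalence *)

Local Open Scope classical_set_scope.

(** * From splayed coordinates to the sum of logarithmic modules *)

Section Directions.
Variables (K : numFieldType) (n : nat).
Local Notation O := (cps K n).

Lemma coordinates_jacobian (y : 'I_n -> O) : coordinates y ->
  \matrix_(i, l) (partial i (y l) : fps K n) 0%MM \in unitmx.
Proof.
move=> [y0 [z [z0 _ zy]]]; set J := \matrix_(i, l) _.
pose N : 'M[K]_n := \matrix_(j, i) (fps_deriv j (z i)) 0%MM.
suff JN : J *m N = 1%:M by case: (mulmx1_unit JN).
apply/matrixP => k i; rewrite !mxE.
rewrite -(fps_coef_nat K n) -fps_deriv_var -zy fps_comp_deriv // fps_coef_sum.
apply: eq_bigr => j _.
by rewrite fps_coef0M fps_comp0 // !mxE mulrC.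
Qed.

Lemma splayed_der_log (g h : O) : splayed (ideal (g * h)) (ideal g) (ideal h) ->
  [set d1 + d2 | d1 in der_log g & d2 in der_log h] = [set: 'rV[O]_n].
Proof.
move=> [y [yc [k [l [kl [_ _ [H1 [H2 [h1 [h2 [h1E h2E [_ gh1] [_ hh2]
  _]]]]]]]]]]].
have [y0 _] := yc; have [B [By yB]] := frame_exists (coordinates_jacobian yc).
apply/seteqP; split=> // d _.
(* The part of [d] along the second block kills the first [k] coordinates, hence [h1]; [d - d1]
   kills the others, hence [h2]. *)
pose d1 := \sum_(i < n | (k <= i)%N) apply_der d (y i) *: row i B.
have d1y (i : 'I_n) :
  apply_der d1 (y i) = if (k <= i)%N then apply_der d (y i) else 0.
  rewrite apply_der_suml.
  have E (j : 'I_n) : apply_der (row j B) (y i) = (j == i)%:R.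
    apply: cps_val_inj; rewrite cps_derE cps_val_nat -By.
    by congr dapp; apply/funext => m; rewrite mxE.
  under eq_bigr do rewrite apply_derZl E.
  case: ifP => ki.
    rewrite (bigD1 i) //= eqxx mulr1 big1 ?addr0 // => j /andP[_ ji].
    by rewrite (negbTE ji) mulr0.
  rewrite big1 // => j kj; case: eqP => [ji|]; last by rewrite mulr0.
  by rewrite -ji kj in ki.
exists d1; last exists (d - d1); last by rewrite addrC subrK.
  apply: (der_log_ideal (esym gh1)); apply: cps_val_inj.
  rewrite cps_derE h1E dapp_comp // big1 // => i _.
  by rewrite -cps_derE d1y /= leqNgt ltn_ord mulr0.
apply: (der_log_ideal (esym hh2)); apply: cps_val_inj.
rewrite cps_derE h2E dapp_comp // big1 // => i _.
rewrite -cps_derE; have -> :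
  apply_der (d - d1) (y (cast_ord kl (rshift k i))) = 0.
  rewrite apply_derDl -scaleN1r apply_derZl d1y /= leq_addr mulN1r subrr //.
by rewrite mulr0.
Qed.

End Directions.

(** * From the sum of logarithmic modules to splayed coordinates *)

Section Converse.
Variables (K : numFieldType) (n : nat).
Local Notation O := (cps K n).
Local Notation conv := (@convergent K n).

Lemma cst_conv a : fps_cst n a \in conv.
Proof. exact: (conv_mono (@ltr01 K) (bnd_cst n a (@ler01 K))). Qed.

Lemma var_conv i : fps_var K i \in conv.
Proof.
rewrite fps_varE; apply: (conv_mono (M := 1) (@ltr01 K)) => d.
apply: (@le_trans _ _ (\sum_(m : 'X_{1..n < d} | bmnm m == U_(i)%MM) 1)).
  rewrite [leRHS]big_mkcond; apply: ler_sum => m _ /=; rewrite expr1n mulr1.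
  by case: eqP => _; rewrite ?normr1 ?normr0.
apply: sumr_le1 => // a b /eqP Ea /eqP Eb.
by apply: val_inj; rewrite /= Ea Eb.
Qed.

(** Inverse function theorem: the inverse germ is the Taylor expansion of the original variables in
    the coordinates [y]. *)
Lemma coordinatesP (y : 'I_n -> O) : (forall i, y i 0%MM = 0) ->
  \matrix_(i, l) (partial i (y l) : fps K n) 0%MM \in unitmx -> coordinates y.
Proof.
move=> y0 yU; have [B [By yB]] := frame_exists yU.
pose z i : O := CPS (taylor_conv id (fun i j => cps_valP (B i j)) (var_conv i)).
have zy i : fps_comp (z i) (fun j => cps_val (y j)) = fps_var K i.
  apply: (taylorE y0 By yB (@inj_id _)) => j.
  by rewrite codom_f.
have z0 i : z i 0%MM = 0.
  rewrite -(fps_comp0 (u := fun j => cps_val (y j))) // zy /=.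
  by case: eqP => // /mnmP/(_ i); rewrite mnm1E mnm0E eqxx.
(* The other composite is the identity because substitution of [y] is injective. *)
split=> //; exists z; split=> // i; apply/eqP; rewrite -subr_eq0; apply/eqP.
apply: (frame_comp_inj y0 By);
  rewrite fps_compB // fps_compA // fps_comp_var //.
rewrite (_ : (fun j => _) = fun j => fps_var K j) ?fps_comp_id ?subrr //.
by apply/funext => j; rewrite zy.
Qed.

(* The blocks of coordinates are told apart by a predicate [P], so that one
   argument covers both components. *)
Lemma adapted_coordinates (A : 'M[K]_n) (P : pred 'I_n) (g : O)
    (d : 'I_n -> 'rV[O]_n) :
    A \in unitmx -> (forall i j, (d i 0 j : fps K n) 0%MM = A i j) ->
    (forall i, P i -> der_log g (d i)) ->
  exists (u q : O) (w : 'I_n -> O) (b : 'I_n -> fps K n),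
    [/\ u \is a GRing.unit, g = u * q,
        forall i, ~~ P i -> w i 0%MM = 0 /\
          forall m, (partial m (w i) : fps K n) 0%MM = invmx A m i &
        forall p, fps_deriv p (cps_val q) =
           \sum_(i | ~~ P i) b i * fps_deriv p (cps_val (w i))].
Proof.
move=> AU dA dg.
(* Linear coordinates dual to the constant fields given by the rows of [A]. *)
pose xi l := \sum_i fps_cst n (invmx A i l) * fps_var K i.
pose Ac i j := fps_cst n (A i j).
have xic l : xi l \in conv.
  by apply: rpred_sum => i _; rewrite rpredM ?cst_conv ?var_conv.
have Acc i j : Ac i j \in conv by apply: cst_conv.
have xi0 l : xi l 0%MM = 0.
  rewrite fps_coef_sum big1 // => i _; rewrite fps_cstM /=.
  by case: eqP => [/mnmP/(_ i)|]; rewrite ?mulr0 // mnm1E mnm0E eqxx.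
have dxi m l : fps_deriv m (xi l) = fps_cst n (invmx A m l).
  rewrite raddf_sum (bigD1 m) //= fps_derivM fps_deriv_cst mul0r add0r.
  rewrite fps_deriv_var eqxx mulr1 big1 ?addr0 // => i im.
  by rewrite fps_derivM fps_deriv_cst mul0r add0r fps_deriv_var eq_sym (negbTE
    im) mulr0.
have Axi i l : dapp (Ac i) (xi l) = (i == l)%:R.
  rewrite /dapp; under eq_bigr do rewrite dxi -(rmorphM (fps_cst n)).
  rewrite -(rmorph_sum (fps_cst n)) -(rmorph_nat (fps_cst n)) /=.
  by congr fps_cst; have /matrixP/(_ i l) := mulmxV AU; rewrite !mxE.
have xiA i k : \sum_l fps_deriv i (xi l) * Ac l k = (i == k)%:R.
  under eq_bigr do rewrite dxi -(rmorphM (fps_cst n)).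
  rewrite -(rmorph_sum (fps_cst n)) -(rmorph_nat (fps_cst n)) /=.
  by congr fps_cst; have /matrixP/(_ i k) := mulVmx AU; rewrite !mxE.
(* The coefficients of [d i] in that constant frame; at the origin they form the identity matrix. *)
pose c i k := dapp (fun j => cps_val (d i 0 j)) (xi k).
have [] := @straighten K n xi Ac xi0 xic Acc Axi xiA (filter P (enum 'I_n)) [::]
  (cps_val g) c (filter_uniq _ (enum_uniq _)) (cps_valP g).
- move=> i k; apply: rpred_sum => j _;
  rewrite rpredM ?cps_valP // dxi cst_conv //.
- by [].
- move=> i k _; rewrite /c fps_coef_sum.
  have /matrixP/(_ i k) := mulmxV AU; rewrite !mxE => <-.
  by apply: eq_bigr => j _; rewrite fps_coef0M dxi fps_cst0 dA.
- move=> i; rewrite mem_filter => /andP[Pi _]; have [a ga] := dg i Pi.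
  exists (cps_val a); first exact: cps_valP.
  by rewrite -(frame_dapp xiA) -cps_derE ga.
move=> u [q [w [b [[uc qc u0 gq] wc w0 qw]]]].
have inP i : (i \notin filter P (enum 'I_n) ++ [::]) = ~~ P i.
  by rewrite cats0 mem_filter mem_enum andbT.
exists (CPS uc), (CPS qc), (fun i => CPS (wc i)), b; split.
- by rewrite cps_unitE /= u0 oner_neq0.
- exact: cps_val_inj.
- move=> i Pi; have [wi0 wi] :
  w i 0%MM = 0 /\ forall k, dapp (Ac k) (w i) 0%MM = (k == i)%:R.
    by apply: w0; rewrite inP.
  split=> // m; rewrite -[LHS]/((fps_deriv m (w i)) 0%MM) (frame_deriv xiA).
  rewrite fps_coef_sum (bigD1 i) // fps_coef0M dxi fps_cst0 wi eqxx mulr1.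
  rewrite big1 ?[LHS]addr0 // => l li.
  by rewrite fps_coef0M wi (negbTE li) mulr0.
- by move=> p; rewrite qw; apply: eq_bigl => i; rewrite inP.
Qed.

Lemma unit_component (g u q : O) : u \is a GRing.unit -> g = u * q ->
  reduced g -> ideal g = ideal q /\ reduced q.
Proof.
move=> uU gq gr; split.
  apply/seteqP; split=> f [a ->].
    by exists (a * u); rewrite gq mulrA.
  by exists (a * u^-1); rewrite gq mulrA mulrVK.
by move=> f [a qa]; apply: gr; exists (u * a); rewrite gq qa mulrA.
Qed.

(** A zero gradient makes [q] constant, hence zero as [g] is not a unit, and zero is not reduced.
    This rules out an empty block of coordinates. *)
Lemma gradient0 (g u q : O) : g \isn't a GRing.unit -> reduced g ->
  u \is a GRing.unit -> g = u * q ->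
  ~ (forall p, fps_deriv p (cps_val q) = 0).
Proof.
move=> gU gr uU gq dq.
have q0 : q 0%MM = 0.
  move: gU; rewrite gq unitrM uU /= cps_unitE negbK => /eqP //.
have q00 : q = 0.
  apply/cps_val_inj/ord_eq0 => -[|d] //.
  by apply: ord_deriv_all => // i; rewrite dq.
have := gr 0; rewrite gq q00 mulr0 unitr0 => H; suff: false by [].
by apply: H; exists 0; rewrite mul0r.
Qed.

Lemma der_log_splayed (g h : O) :
    g \isn't a GRing.unit -> h \isn't a GRing.unit -> reduced g -> reduced h ->
    [set d1 + d2 | d1 in der_log g & d2 in der_log h] = [set: 'rV[O]_n] ->
  splayed (ideal (g * h)) (ideal g) (ideal h).
Proof.
move=> gU hU gr hr sumE.
have decomp (i : 'I_n) : exists d : 'rV[O]_n * 'rV[O]_n,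
    [/\ der_log g d.1, der_log h d.2 & d.1 + d.2 = delta_mx 0 i].
  have : [set: 'rV[O]_n] (delta_mx 0 i) by [].
  by rewrite -sumE => -[d1 gd1 [d2 hd2 dE]]; exists (d1, d2).
have [d dP] := fin_all_exists decomp.
pose D1 : 'M[K]_n := \matrix_(i, j) ((d i).1 0 j : fps K n) 0%MM.
pose D2 : 'M[K]_n := \matrix_(i, j) ((d i).2 0 j : fps K n) 0%MM.
have D12 : D1 + D2 = 1%:M.
  apply/matrixP => i j; have [_ _ /matrixP/(_ 0 j)] := dP i.
  rewrite !mxE eqxx /= => /(congr1 (@cst_term K n));
    rewrite rmorphD rmorph_nat /=.
  by rewrite eq_sym.
have [k [l [kl [A [C [AU AC]]]]]] := complementary_rows D12.
pose cst (a : K) : O := CPS (cst_conv a).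
(* Constant combinations of the chosen logarithmic fields, with value row [i] of [A] at the
   origin. *)
pose del i : 'rV[O]_n :=
  \sum_m cst (C i m) *: (if (i < k)%N then (d m).2 else (d m).1).
have delA i j : (del i 0 j : fps K n) 0%MM = A i j.
  have /rowP/(_ j) := AC i; rewrite !mxE => ->.
  rewrite summxE cps_val_sum fps_coef_sum; apply: eq_bigr => m _.
  rewrite mxE cps_valM fps_coef0M fps_cst0.
  by case: ifP => _; rewrite mxE.
have der_logS f (e : 'I_n -> 'rV[O]_n) (a : 'I_n -> O) :
    (forall m, der_log f (e m)) -> der_log f (\sum_m a m *: e m).
  move=> ef; have [b be] := fin_all_exists ef.
  exists (\sum_m a m * b m); rewrite apply_der_suml mulr_suml.
  by apply: eq_bigr => m _; rewrite apply_derZl be mulrA.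
have delg (i : 'I_n) : ~~ (i < k)%N -> der_log g (del i).
  by move=> /negbTE ik; apply: der_logS => m; rewrite ik; case: (dP m).
have delh (i : 'I_n) : (i < k)%N -> der_log h (del i).
  by move=> ik; apply: der_logS => m; rewrite ik; case: (dP m).
have [u1 [h1 [w [b1 [u1U gh1 w0 h1w]]]]] := adapted_coordinates AU delA delg.
have [u2 [h2 [v [b2 [u2U hh2 v0 h2v]]]]] := adapted_coordinates AU delA delh.
(* Both families have as differentials at the origin columns of the same matrix [invmx A], so the
   mixed family has an invertible Jacobian. *)
pose y (i : 'I_n) := if (i < k)%N then w i else v i.
have y0 i : y i 0%MM = 0.
  rewrite /y; case: ifP => ik; first by case: (w0 i) => //; rewrite negbK.
  by case: (v0 i) => //; rewrite ik.
have yJ : \matrix_(i, l) (partial i (y l) : fps K n) 0%MM = invmx A.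
  apply/matrixP => m i; rewrite mxE /y; case: ifP => ik.
    by case: (w0 i) => [|_ ->] //; rewrite negbK.
  by case: (v0 i) => [|_ ->] //; rewrite ik.
have yU : \matrix_(i, l) (partial i (y l) : fps K n) 0%MM \in unitmx.
  by rewrite yJ unitmx_inv.
have [B [By yB]] := frame_exists yU.
pose i1 (i : 'I_k) := cast_ord kl (lshift l i).
pose i2 (i : 'I_l) := cast_ord kl (rshift k i).
have i1_inj : injective i1 by move=> a b /cast_ord_inj/lshift_inj.
have i2_inj : injective i2 by move=> a b /cast_ord_inj/rshift_inj.
have codom1 j : j \notin codom i1 -> ~~ (j < k)%N.
  apply: contra => jk; apply/codomP; exists (Ordinal jk).
  exact: val_inj.
have codom2 j : j \notin codom i2 -> (j < k)%N.
  apply: contraR; rewrite -leqNgt => kj.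
  have jl : (j - k < l)%N by rewrite ltn_subLR // kl.
  by apply/codomP; exists (Ordinal jl); apply: val_inj; rewrite /= subnKC.
(* If dq is a combination of the dy_i with [P i], the dual fields outside [P] kill [q], as [taylorE]
   requires. *)
have Bgrad (q : O) (P : pred 'I_n) b j :
    (forall p, fps_deriv p (cps_val q) =
           \sum_(i | P i) b i * fps_deriv p (cps_val (y i))) ->
    ~~ P j -> dapp (fun m => cps_val (B j m)) (cps_val q) = 0.
  move=> qb Pj; rewrite /dapp; under eq_bigr do rewrite qb mulr_sumr.
  rewrite exchange_big big1 // => i Pi; under eq_bigr do rewrite mulrCA.
  rewrite -mulr_sumr -[X in _ * X]/(dapp _ _) By.
  by case: eqP Pj => [->|]; rewrite ?Pi // mulr0.
have h1y p : fps_deriv p (cps_val h1) =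
    \sum_(i : 'I_n | (i < k)%N) b1 i * fps_deriv p (cps_val (y i)).
  rewrite h1w; apply: eq_big => i; first by rewrite negbK.
  by rewrite negbK /y => ->.
have h2y p : fps_deriv p (cps_val h2) =
    \sum_(i : 'I_n | ~~ (i < k)%N) b2 i * fps_deriv p (cps_val (y i)).
  by rewrite h2v; apply: eq_bigr => i /negbTE; rewrite /y => ->.
have Bc i j := cps_valP (B i j).
exists y; split; first exact: coordinatesP.
exists k, l, kl; split.
- rewrite lt0n; apply/eqP => k0; apply: (gradient0 gU gr u1U gh1) => p.
  by rewrite h1y big1 // => i; rewrite k0.
- rewrite lt0n; apply/eqP => l0; apply: (gradient0 hU hr u2U hh2) => p.
  rewrite h2y big1 // => i; rewrite -leqNgt leqNgt.
  by rewrite -[k]addn0 -l0 kl ltn_ord.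
have [ig gr1] := unit_component u1U gh1 gr;
  have [ih hr2] := unit_component u2U hh2 hr.
exists (CPS (taylor_conv i1 Bc (cps_valP h1))),
  (CPS (taylor_conv i2 Bc (cps_valP h2))), h1, h2; split=> //.
- rewrite [RHS](taylorE y0 By yB i1_inj) // => j /codom1.
  exact: Bgrad h1y.
- rewrite [RHS](taylorE y0 By yB i2_inj) // => j /codom2 jk.
  by apply: (Bgrad _ _ _ _ h2y); rewrite negbK.
- apply/seteqP; split=> f [a ->].
    by exists (a * u1 * u2); rewrite gh1 hh2; ring.
  exists (a * (u1 * u2)^-1); rewrite gh1 hh2 [u1 * h1 * _]mulrACA.
  by rewrite [RHS]mulrA mulrVK // unitrM u1U.
Qed.

End Converse.

Theorem proposition3p10 (R : realType) (n : nat) (g h : cps R[i] n)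
    (g_nonunit : g \isn't a GRing.unit) (h_nonunit : h \isn't a GRing.unit)
    (g_reduced : reduced g) (h_reduced : reduced h)
    (gh_coprime : no_common_factor g h) :
  splayed (ideal (g * h)) (ideal g) (ideal h) <->
  [set d1 + d2 | d1 in der_log g & d2 in der_log h] = [set: 'rV[cps R[i] n]_n].
Proof.
split; first exact: splayed_der_log.
exact: der_log_splayed.
Qed.
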